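(* For every $X$ with $d=\operatorname{rank}(X)$ and every model universe $\mathcal M$, $$K(X,\mathcal M,\alpha,r)\ \le\ K_{\mathrm{Sch}}(\alpha,d,r),$$ where $K_{\mathrm{Sch}}(\alpha,d,r)=\sqrt{d\,F_{d,r,1-\alpha}}$ and $F_{d,r,1-\alpha}$ is the $(1-\alpha)$-quantile of the $F$-distribution with $d$ and $r$ degrees of freedom.
   Context: Setting. $X=(X_1,\dots,X_p)$ is a fixed real $n\times p$ matrix with $d=\operatorname{rank}(X)\ge 1$ ($n,p$ arbitrary). $Y\sim N(\mu,\sigma^2 I_n)$, where $\mu\in\mathbb R^n$ is arbitrary and $\sigma>0$. $\hat\sigma>0$ is a random variable with $\hat\sigma^2\sim\sigma^2\chi^2_r/r$ ($r$ degrees of freedom), independent of all least squares estimates $\hat\beta_M$ below, i.e. of the orthogonal projection of $Y$ onto the column space of $X$. Submodels. For nonempty $M\subset\{1,\dots,p\}$, $X_M$ is the submatrix of columns indexed by $M$. $\mathcal M_{\mathrm{all}}=\{M: M\ne\varnothing,\ \operatorname{rank}(X_M)=|M|\}$. A model universe $\mathcal M$ is a nonempty subset of $\mathcal M_{\mathrm{all}}$ with $\bigcup_{M\in\mathcal M}M=\{1,\dots,p\}$. For $M\in\mathcal M_{\mathrm{all}}$: $\hat\beta_M=(X_M^TX_M)^{-1}X_M^TY$ and $\beta_M=E[\hat\beta_M]$, with components indexed by $j\in M$. $X_{j\cdot M}$ ($j\in M$) is the residual vector of $X_j$ after orthogonal projection onto the span of $\{X_k:k\in M\setminus\{j\}\}$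 (equal to $X_j$ if $M=\{j\}$). Define $$t_{j\cdot M}=\frac{\hat\beta_{j\cdot M}-\beta_{j\cdot M}}{\hat\sigma/\|X_{j\cdot M}\|}=\frac{(Y-\mu)^TX_{j\cdot M}}{\hat\sigma\|X_{j\cdot M}\|}.$$ PoSI constant. For $\alpha\in(0,1)$, $K(X,\mathcal M,\alpha,r)$ is the minimal $K$ with $P[\max_{M\in\mathcal M}\max_{j\in M}|t_{j\cdot M}|\le K]\ge1-\alpha$. *)

(* Defs.v *)
From HB Require Import structures.
From mathcomp Require Import all_boot all_order all_algebra.
From mathcomp Require Import all_classical all_reals all_analysis.
From mathcomp Require Import measurable_realfun.

Set Implicit Arguments.
Unset Strict Implicit.
Unset Printing Implicit Defensive.

Import Order.TTheory GRing.Theory Num.Theory.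

Local Open Scope classical_set_scope.
Local Open Scope ring_scope.

Section laws.
Context {R : realType}.

Definition tuple_cons (n : nat) (z : measurableTypeR R * n.-tuple R) :
    n.+1.-tuple R :=
  [tuple of z.1 :: z.2].

Lemma measurable_tuple_cons (n : nat) :
  measurable_fun [set: measurableTypeR R * n.-tuple R] (@tuple_cons n).
Proof. exact: (measurable_cons measurable_fst measurable_snd). Qed.

HB.instance Definition _ (n : nat) :=
  isMeasurableFun.Build _ _ _ _ (@tuple_cons n) (@measurable_tuple_cons n).

(* The law of k independent N(0,1) variables: the k-fold product of the
   standard normal law. *)
Fixpoint std_normal_prob (k : nat) : probability (k.-tuple R) R :=
  match k with
  | 0 => \d_([tuple] : 0.-tuple R)
  | k'.+1 => distribution (normal_prob (0 : R) 1 \x std_normal_prob k')%E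
               (@tuple_cons k')
  end.

Definition sum_squares (k : nat) (x : k.-tuple R) : R :=
  \sum_(i < k) tnth x i ^+ 2.

Lemma measurable_sum_squares (k : nat) :
  measurable_fun [set: k.-tuple R] (@sum_squares k).
Proof.
apply: measurable_sum => i; apply: measurable_funX; exact: measurable_tnth.
Qed.

HB.instance Definition _ (k : nat) :=
  isMeasurableFun.Build _ _ _ _ (@sum_squares k) (@measurable_sum_squares k).

Definition chi2_prob (k : nat) : probability R R :=
  distribution (std_normal_prob k) (@sum_squares k).

(* The law of (U / d) / (V / r) for independent U ~ chi2_d and V ~ chi2_r. *)
Definition F_prob (d r : nat) : set R -> \bar R :=
  pushforward (chi2_prob d \x chi2_prob r)%E
    (fun z : R * R => (z.1 / d%:R) / (z.2 / r%:R)).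

Definition quantile (Q : set R -> \bar R) (q : R) : R :=
  inf [set x : R | (q%:E <= Q `]-oo, x]%classic)%E].

Definition K_Sch (alpha : R) (d r : nat) : R :=
  Num.sqrt (d%:R * quantile (F_prob d r) (1 - alpha)).

End laws.

Section random_vectors.
Context {d0 : measure_display} {T : measurableType d0} {R : realType}.
Variable P : probability T R.

Definition independent d1 d2 (T1 : measurableType d1) (T2 : measurableType d2)
    (U : T -> T1) (V : T -> T2) : Prop :=
  forall (A : set T1) (B : set T2), measurable A -> measurable B ->
    (P (U @^-1` A `&` V @^-1` B) = P (U @^-1` A) * P (V @^-1` B))%E.

(* Y ~ N(mu, sigma^2 I_n): Y is a random vector whose law is the product of the
   laws N(mu_i, sigma^2).  The second argument of normal_prob is the standard
   deviation. *)
Definition normal_vector (n : nat) (Y : T -> 'cV[R]_n) (mu : 'cV[R]_n)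
    (sigma : R) : Prop :=
  (forall i, measurable_fun [set: T] (fun w => Y w i ord0)) /\
  forall A : 'I_n -> set R, (forall i, measurable (A i)) ->
    P [set w | forall i, A i (Y w i ord0)] =
    (\prod_(i < n) normal_prob (mu i ord0) sigma (A i))%E.

(* s ^ 2 ~ sigma ^ 2 chi2_r / r *)
Definition scaled_chi2 (s : T -> R) (sigma : R) (r : nat) : Prop :=
  forall A : set R, measurable A ->
    P [set w | A (s w ^+ 2)] =
    pushforward (chi2_prob r) (fun x => sigma ^+ 2 * x / r%:R) A.

End random_vectors.

Section linear_models.
Context {R : realType} {n p : nat}.

(* The matrix norm `|v| of the library is the sup norm. *)
Definition norm2 (v : 'cV[R]_n) : R := Num.sqrt (\sum_(i < n) v i ord0 ^+ 2).

(* The orthogonal projection of R^n onto the column space of A, that is, along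
   {v | v^T A = 0}.  MathComp's subspaces are row spaces, whence the
   transpositions. *)
Definition orth_proj (q : nat) (A : 'M[R]_(n, q)) : 'M[R]_n :=
  (proj_mx <<A^T>>%MS (kermx A))^T.

Variable X : 'M[R]_(n, p).

(* The columns of X_M, hence the components of the estimates below, are indexed
   by k : 'I_#|M|; the corresponding j in M is enum_val k. *)
Definition submodel (M : {set 'I_p}) : 'M[R]_(n, #|M|) :=
  colsub (fun k : 'I_#|M| => enum_val k) X.

Definition M_all : {set {set 'I_p}} :=
  [set M : {set 'I_p} | (M != finset.set0) && (\rank (submodel M) == #|M|)]%SET.

Definition model_universe (MM : {set {set 'I_p}}) : Prop :=
  [/\ MM != finset.set0, MM \subset M_all &
      (\bigcup_(M in MM) M)%SET = [set: 'I_p]%SET].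

Definition lse (M : {set 'I_p}) (y : 'cV[R]_n) : 'cV[R]_#|M| :=
  invmx ((submodel M)^T *m submodel M) *m (submodel M)^T *m y.

(* X_{j.M} *)
Definition adj_col (M : {set 'I_p}) (j : 'I_p) : 'cV[R]_n :=
  col j X - orth_proj (submodel (M :\ j)%SET) *m col j X.

Context {d0 : measure_display} {T : measurableType d0}.
Variables (P : probability T R) (Y : T -> 'cV[R]_n) (shat : T -> R).

Definition lse_mean (M : {set 'I_p}) : 'cV[R]_#|M| :=
  \col_k fine ('E_P[fun w => lse M (Y w) k ord0])%E.

Definition t_stat (M : {set 'I_p}) (k : 'I_#|M|) (w : T) : R :=
  (lse M (Y w) k ord0 - lse_mean M k ord0) /
  (shat w / norm2 (adj_col M (enum_val k))).

(* The default value 0 of the maxima is harmless, the values being nonnegative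
   and the index sets nonempty. *)
Definition max_abs_t (MM : {set {set 'I_p}}) (w : T) : R :=
  \big[Num.max/0]_(M in MM) \big[Num.max/0]_(k < #|M|) `|t_stat k w|.

(* The infimum is a minimum: see PoSI_const_min. *)
Definition PoSI_const (MM : {set {set 'I_p}}) (alpha : R) : R :=
  inf [set K : R | ((1 - alpha)%:E <= P [set w | max_abs_t MM w <= K]%R)%E].

Context (mY : forall i, measurable_fun [set: T] (fun w => Y w i ord0))
  (mshat : measurable_fun [set: T] shat) (shat_gt0 : forall w, 0 < shat w).

Lemma measurable_t_stat (M : {set 'I_p}) (k : 'I_#|M|) :
  measurable_fun [set: T] (@t_stat M k).
Proof.
rewrite /t_stat; apply: measurable_funM.
  apply: measurable_funB => //; rewrite /lse.
  under eq_fun do rewrite mxE.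
  by apply: measurable_sum => i; apply: measurable_funM => //; exact: mY.
have -> : (fun w => (shat w / norm2 (adj_col M (enum_val k)))^-1) =
    (fun w => expR (- ln (shat w)) * norm2 (adj_col M (enum_val k))).
  apply/funext => w; rewrite invfM invrK; congr (_ * _).
  by rewrite expRN lnK// posrE.
apply: measurable_funM => //; apply: measurableT_comp => //.
by apply: measurable_funN; exact: measurableT_comp.
Qed.

Lemma measurable_max_abs_t (MM : {set {set 'I_p}}) :
  measurable_fun [set: T] (max_abs_t MM).
Proof.
have bigmax (I : Type) (s : seq I) (Q : pred I) (f : I -> T -> R) :
    (forall i, measurable_fun [set: T] (f i)) ->
    measurable_fun [set: T] (fun w => \big[Num.max/0]_(i <- s | Q i) f i w).
  move=> mf; elim: s => [|i s IH].
    rewrite (_ : (fun w => _) = cst 0); first exact: measurable_cst.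
    by apply/funext => w; rewrite big_nil.
  rewrite (_ : (fun w => _) = if Q i then
      f i \max (fun w => \big[Num.max/0]_(i <- s | Q i) f i w)
    else fun w => \big[Num.max/0]_(i <- s | Q i) f i w).
    by case: (Q i) => //; exact: measurable_maxr.
  by apply/funext => w; rewrite big_cons; case: (Q i).
apply: (bigmax) => M; apply: (bigmax) => k.
by apply: measurableT_comp => //; exact: measurable_t_stat.
Qed.

Lemma PoSI_const_min (MM : {set {set 'I_p}}) (alpha : R) : 0 < alpha < 1 ->
  let S := [set K : R | ((1 - alpha)%:E <= P [set w | max_abs_t MM w <= K]%R)%E]
  in S (PoSI_const MM alpha) /\ lbound S (PoSI_const MM alpha).
Proof.
move=> /andP[a0 a1] S.
pose Z : {RV P >-> R} := HB.pack (max_abs_t MM)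
  (isMeasurableFun.Build _ _ _ _ (max_abs_t MM) (measurable_max_abs_t MM)).
have SE x : S x = ((1 - alpha)%:E <= cdf Z x)%E by [].
have mono := cdf_nondecreasing Z.
have S0 : S !=set0.
  have /(cvg_cdfy1 Z) [A [_ h]] :
      nbhs (1%:E : \bar R) [set y | ((1 - alpha)%:E < y)%E].
    apply: open_nbhs_nbhs; split; first exact: open_ereal_gt_ereal.
    by rewrite /= lte_fin gtrBl.
  exists (A + 1); rewrite SE ltW//.
  by apply: h; rewrite ltrDl.
have lbS : has_lbound S.
  have /(cvg_cdfNy0 Z) [A [_ h]] :
      nbhs (0%:E : \bar R) [set y | (y < (1 - alpha)%:E)%E].
    apply: open_nbhs_nbhs; split; first exact: open_ereal_lt_ereal.
    by rewrite /= lte_fin subr_gt0.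
  exists (A - 1) => x; rewrite SE => Sx; rewrite leNgt; apply/negP => xA.
  have : (cdf Z x < (1 - alpha)%:E)%E.
    by apply: h; rewrite (lt_trans xA)// gtrBl.
  by rewrite ltNge Sx.
split; last by move=> x Sx; exact: ge_inf.
rewrite SE leNgt; apply/negP => lt1.
have /(@cdf_right_continuous _ _ _ _ Z) [e /= e0 he] :
    nbhs (cdf Z (PoSI_const MM alpha)) [set y | (y < (1 - alpha)%:E)%E].
  by apply: open_nbhs_nbhs; split => //; exact: open_ereal_lt_ereal.
have [y Sy ylt] := inf_adherent e0 (conj S0 lbS).
have yge : PoSI_const MM alpha <= y by exact: ge_inf.
move: (Sy); rewrite SE leNgt => /negP; apply.
have [<-//|neq] := eqVneq (PoSI_const MM alpha) y.
apply: he => /=; last by rewrite lt_neqAle neq.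
by rewrite ler0_norm ?subr_le0// opprB ltrBlDl.
Qed.

End linear_models.

(* Main.v *)
From HB Require Import structures.
Require Import Defs.
From mathcomp Require Import all_boot all_order all_algebra.
From mathcomp Require Import all_classical all_reals all_analysis.
From mathcomp Require Import measurable_realfun ring.

Set Implicit Arguments.
Unset Strict Implicit.
Unset Printing Implicit Defensive.

Import Order.TTheory GRing.Theory Num.Theory.
Local Open Scope classical_set_scope.
Local Open Scope ring_scope.

(** A t-statistic of a submodel is, up to the common factor 1 / shat, the scalar
    product of Y - mu with the unit vector along X_{j.M}.  All these unit
    vectors lie in the column space of X, so by Cauchy-Schwarz every |t| is at
    most the length of the projection of Y - mu onto that space, divided by
    shat ([max_abs_t_bound]).  This bound does not depend on the model
    universe, and its square divided by d has the F distribution with d and r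
    degrees of freedom: it is Scheffe's pivot ([pivot_F_law]).  The smallest
    level K that is exceeded by the maximum with probability at most alpha is
    therefore at most the square root of d times the quantile of F
    ([inf_quantile_sqrt_le]).

    Three ingredients carry the argument.

    - Geometry.  The rows of a matrix Q form an orthonormal basis of the column
      space of X ([orthonormal_column_basis]), so that |Q z| is the length of
      the projection of z.  The identity of Frisch and Waugh ([lse_adj_col])
      expresses a coefficient of least squares as a scalar product with
      X_{j.M}.

    - The law of |Q z|^2 for a standard normal vector z is chi-square
      ([sqnorm_orthonormal_law]).  This is the rotation invariance of the
      standard normal law.  It is reduced to dimension two: a reflection of
      the plane preserves the product of two standard normal laws, because it
      preserves both x^2 + y^2 and, by Fubini and affine substitutions,
      Lebesgue measure ([ge0_integral_normal_reflect]).  Finitely many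
      reflections of two neighbouring coordinates bring the first row of Q to a
      multiple of the first basis vector ([std_invariant_align]); the other
      rows are then orthogonal to it, and the chi-square law follows by
      induction on the number of rows.

    - Centring.  The statistics are centred at the expectations of the least
      squares estimates; these are the estimates at mu, by linearity and since
      the coordinates of Y are integrable with mean mu
      ([normal_vector_mean]). *)

(** * Affine substitutions in Lebesgue integrals *)

Section Affine.
Context {R : realType}.
Local Notation leb := (@lebesgue_measure R).
Local Notation BR := (measurableTypeR R).

Let affine (a b : R) : BR -> BR := fun x => a * x + b.

Let measurable_affine (a b : R) : measurable_fun [set: BR] (affine a b).
Proof. by apply: measurable_funD => //; exact: measurable_funM. Qed.

Lemma lebesgue_affine_gt0 (a b : R) (A : set BR) : 0 < a -> measurable A ->
  leb A = (a%:E * leb ((fun x : BR => (a * x + b)%R) @^-1` A))%E.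
Proof.
move=> a0 mA.
have mf := measurable_affine a b.
pose m := mscale (NngNum (ltW a0)) (pushforward leb (affine a b))
  : {measure set BR -> \bar R}.
rewrite -[RHS]/(m mf A).
apply: lebesgue_measure_unique => //= _ [[u v]] _ <-.
rewrite /m /mscale/= /pushforward/=.
rewrite (_ : _ @^-1` _ = `](u - b) / a, (v - b) / a]%classic); last first.
  apply/seteqP; split => x /=; rewrite !in_itv/= ltr_pdivrMr// ler_pdivlMr//;
    by rewrite ltrBlDr lerBrDr (mulrC x).
rewrite !lebesgue_measure_itv/= !lte_fin ltr_pM2r ?invr_gt0// ltrD2r.
case: ifPn => _; last by rewrite mule0.
by rewrite -!EFinB -EFinM; congr _%:E; field; rewrite gt_eqF.
Qed.

Lemma lebesgue_affine (a b : R) (A : set BR) : a != 0 -> measurable A ->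
  leb A = (`|a|%:E * leb ((fun x : BR => (a * x + b)%R) @^-1` A))%E.
Proof.
case: (ltrgtP a 0) => // a0 _ mA; last first.
  by rewrite gtr0_norm//; exact: lebesgue_affine_gt0.
have mf : measurable ((fun x : BR => a * x + b) @^-1` A).
  by rewrite -[X in measurable X]setTI; exact: measurable_affine.
rewrite ltr0_norm// -(lebesgue_measureN mf) /pushforward.
rewrite (@lebesgue_affine_gt0 (- a) b)// ?oppr_gt0//; congr (_ * leb _)%E.
by apply/seteqP; split => x /=; rewrite mulNr mulrN.
Qed.

Lemma ge0_integral_affine (a b : R) (f : BR -> \bar R) : a != 0 ->
  measurable_fun [set: BR] f -> (forall x, 0 <= f x)%E ->
  (\int[leb]_x f (a * x + b)%R = `|a|^-1%:E * \int[leb]_x f x)%E.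
Proof.
move=> a0 mf f0.
have mg := measurable_affine a b.
transitivity (\int[pushforward leb (affine a b)]_x f x)%E.
  by rewrite ge0_integral_pushforward.
have na : 0 <= `|a| by [].
pose m := mscale (NngNum na) (pushforward leb (affine a b))
  : {measure set BR -> \bar R}.
transitivity (`|a|^-1%:E * \int[m mg]_x f x)%E.
  by rewrite /m ge0_integral_mscale//= muleA -EFinM mulVf ?normr_eq0// mul1e.
congr (_ * _)%E; apply: eq_measure_integral => A mA _.
by rewrite /m /mscale/= /pushforward; exact/esym/lebesgue_affine.
Qed.

End Affine.

(** * Invariance of the planar standard normal law under reflections *)

Section Normal.
Context {R : realType}.
Local Notation leb := (@lebesgue_measure R).
Local Notation BR := (measurableTypeR R).
Local Notation N01 := (normal_prob (0 : R) 1).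
Local Notation phi := (normal_pdf (0 : R) 1).

(** [normal_prob] gives the measure of sets as the integral of the density; the
    formula for functions holds because the density is almost everywhere equal
    to the Radon-Nikodym derivative. *)
Lemma ge0_integral_normal (m s : R) (f : BR -> \bar R) :
  measurable_fun [set: BR] f -> (forall x, 0 <= f x)%E ->
  (\int[normal_prob m s]_x f x = \int[leb]_x (f x * (normal_pdf m s x)%:E))%E.
Proof.
move=> mf f0.
rewrite -(Radon_Nikodym_SigmaFinite.change_of_variables
  (normal_prob_dominates m s) f0 measurableT mf).
have mpdf : measurable_fun [set: BR] (EFin \o normal_pdf m s).
  by apply/measurable_EFinP; exact: measurable_normal_pdf.
have iRN := Radon_Nikodym_SigmaFinite.f_integrable (normal_prob_dominates m s).
apply: ae_eq_integral => //.
- by apply: emeasurable_funM => //; exact: measurable_int iRN.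
- exact: emeasurable_funM.
apply: ae_eqe_mul2l.
apply: integral_ae_eq => // E _ mE.
by rewrite -Radon_Nikodym_SigmaFinite.f_integral//; exact: normal_prob_dominates.
Qed.

Lemma normal_pdf_reflect (a b x y : R) : a ^+ 2 + b ^+ 2 = 1 ->
  phi (a * x + b * y) * phi (b * x - a * y) = phi x * phi y.
Proof.
move=> ab; rewrite normal_pdfE ?oner_eq0//= /normal_fun.
rewrite mulrACA [RHS]mulrACA -!expRD; congr (_ * expR _).
rewrite !subr0 -!mulrDl -!opprD; congr (- _ * _).
rewrite -[RHS]mul1r -ab; ring.
Qed.

Lemma ge0_integral_normal2 (F : BR * BR -> \bar R) :
  measurable_fun [set: BR * BR] F -> (forall z, 0 <= F z)%E ->
  (\int[N01]_x \int[N01]_y F (x, y) =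
   \int[leb]_x \int[leb]_y (F (x, y) * (phi x * phi y)%:E))%E.
Proof.
move=> mF F0.
rewrite ge0_integral_normal; first last.
- by move=> x; exact: integral_ge0.
- exact: (@measurable_fun_fubini_tonelli_F _ _ _ _ _ N01 F).
apply: eq_integral => x _.
rewrite ge0_integral_normal//; last exact/measurableT_comp.
rewrite -ge0_integralZr//; first last.
- by rewrite lee_fin normal_pdf_ge0.
- by move=> y _; rewrite mule_ge0// lee_fin normal_pdf_ge0.
- apply: emeasurable_funM; first exact/measurableT_comp.
  by apply/measurable_EFinP; exact: measurable_normal_pdf.
by apply: eq_integral => y _; rewrite -muleA -EFinM [in LHS]mulrC.
Qed.

Let swap_leb (G : BR * BR -> \bar R) :
  measurable_fun [set: BR * BR] G -> (forall z, 0 <= G z)%E ->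
  (\int[leb]_x \int[leb]_y G (x, y) = \int[leb]_y \int[leb]_x G (x, y))%E.
Proof. exact: fubini_tonelli. Qed.

(** The map (x, y) |-> (a x + b y, b x - a y) is an orthogonal reflection.  It
    leaves the joint density unchanged, and the planar Lebesgue integral is
    transformed one variable at a time: for fixed y the inner variable x is
    replaced by u = b x - a y, which costs a factor 1 / |b|, and after an
    exchange of the integrals y is replaced by v = (y + a u) / b, which gives
    the factor |b| back.  For b = 0 the first substitution breaks down, and
    the map only changes signs. *)
Lemma ge0_integral_normal_reflect (a b : R) (F : BR * BR -> \bar R) :
  a ^+ 2 + b ^+ 2 = 1 -> b != 0 ->
  measurable_fun [set: BR * BR] F -> (forall z, 0 <= F z)%E ->
  (\int[N01]_x \int[N01]_y F ((a * x + b * y)%R, (b * x - a * y)%R) =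
   \int[N01]_x \int[N01]_y F (x, y))%E.
Proof.
move=> ab b0 mF F0.
have mrefl : measurable_fun [set: BR * BR]
    (fun z : BR * BR => (a * z.1 + b * z.2, b * z.1 - a * z.2) : BR * BR).
  apply: measurable_fun_pair.
    by apply: measurable_funD; exact: measurable_funM.
  by apply: measurable_funB; exact: measurable_funM.
rewrite (ge0_integral_normal2 (F := fun z =>
  F ((a * z.1 + b * z.2)%R, (b * z.1 - a * z.2)%R)))//=; last first.
  exact: (measurableT_comp mF mrefl).
rewrite [RHS](ge0_integral_normal2 mF F0).
pose G (z : BR * BR) := (F z * (phi z.1 * phi z.2)%:E)%E.
have mphi : measurable_fun [set: BR] phi by exact: measurable_normal_pdf.
have mG : measurable_fun [set: BR * BR] G.
  apply: emeasurable_funM => //; apply/measurable_EFinP.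
  by apply: measurable_funM; exact: measurableT_comp.
have G0 z : (0 <= G z)%E by rewrite mule_ge0// lee_fin mulr_ge0// normal_pdf_ge0.
pose K (z : BR * BR) := G (a * z.1 + b * z.2, b * z.1 - a * z.2).
transitivity (\int[leb]_x \int[leb]_y K (x, y))%E.
  by apply: eq_integral => x _; apply: eq_integral => y _;
    rewrite /K /G/= normal_pdf_reflect.
have mK : measurable_fun [set: BR * BR] K by exact: (measurableT_comp mG mrefl).
have K0 z : (0 <= K z)%E by exact: G0.
rewrite [LHS](swap_leb mK K0).
(* H (y, u) is the integrand after the substitution u = b x - a y, for which
   a x + b y = (y + a u) / b *)
pose H (z : BR * BR) := G (b^-1 * z.1 + a / b * z.2, z.2).
have H0 z : (0 <= H z)%E by exact: G0.
have mH : measurable_fun [set: BR * BR] H.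
  apply: (measurableT_comp mG); apply: measurable_fun_pair => //.
  by apply: measurable_funD; exact: measurable_funM.
transitivity (\int[leb]_y (`|b|^-1%:E * \int[leb]_u H (y, u)))%E.
  apply: eq_integral => y _.
  have mHy : measurable_fun [set: BR] (fun u => H (y, u)).
    exact/measurableT_comp.
  transitivity (\int[leb]_x H (y, (b * x + - (a * y))%R))%E; last first.
    by apply: (ge0_integral_affine (- (a * y)) b0 mHy) => u; exact: H0.
  apply: eq_integral => x _; rewrite /H /K /=; congr (G (_, _)).
  transitivity (b^-1 * ((a ^+ 2 + b ^+ 2) * y) + a / b * (b * x - a * y)).
    by field.
  by rewrite ab mul1r.
rewrite [LHS]ge0_integralZl//; last first.
  by move=> y _; exact: integral_ge0.
  exact: (measurable_fun_fubini_tonelli_F H mH H0).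
transitivity (`|b|^-1%:E * \int[leb]_u \int[leb]_y H (y, u))%E.
  by apply: congr1; exact: (swap_leb mH H0).
transitivity (`|b|^-1%:E * \int[leb]_u (`|b|%:E * \int[leb]_v G (v, u)))%E.
  apply: congr1; apply: eq_integral => u _.
  have mGu : measurable_fun [set: BR] (fun v => G (v, u)).
    exact/measurableT_comp.
  rewrite [LHS](ge0_integral_affine (a / b * u) (invr_neq0 b0) mGu)//.
  by rewrite normfV invrK.
rewrite [in LHS]ge0_integralZl//; last first.
  by move=> y _; exact: integral_ge0.
  exact: (measurable_fun_fubini_tonelli_G G mG G0).
rewrite muleA -EFinM mulVf ?normr_eq0// mul1e.
exact: (esym (swap_leb mG G0)).
Qed.

End Normal.

(** * Orthogonal invariance of the standard normal law *)

Section Tuples.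
Context {R : realType}.
Local Notation BR := (measurableTypeR R).
Local Notation N01 := (normal_prob (0 : R) 1).
Local Notation std := (@std_normal_prob R).

Definition tuple_col n (x : n.-tuple R) : 'cV[R]_n := \col_i tnth x i.

Definition tuple_mulmx m n (G : 'M[R]_(m, n)) (x : n.-tuple R) : m.-tuple R :=
  [tuple (G *m tuple_col x) i ord0 | i < m].

Definition sqnorm n (v : 'cV[R]_n) : R := \sum_i v i ord0 ^+ 2.

Lemma tuple_col_mulmx m n (G : 'M[R]_(m, n)) x :
  tuple_col (tuple_mulmx G x) = G *m tuple_col x.
Proof. by apply/matrixP => i j; rewrite mxE tnth_mktuple (ord1 j). Qed.

Lemma tuple_col_inj n : injective (@tuple_col n).
Proof.
move=> x y /matrixP e; apply: eq_from_tnth => i.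
by have := e i ord0; rewrite !mxE.
Qed.

Lemma tuple_mulmxM m n p (G : 'M[R]_(m, n)) (H : 'M[R]_(n, p)) x :
  tuple_mulmx (G *m H) x = tuple_mulmx G (tuple_mulmx H x).
Proof. by rewrite /tuple_mulmx -/(tuple_mulmx H x) tuple_col_mulmx mulmxA. Qed.

Lemma tuple_mulmx1 n (x : n.-tuple R) : tuple_mulmx 1%:M x = x.
Proof. by apply: eq_from_tnth => i; rewrite tnth_mktuple mul1mx mxE. Qed.

Lemma tuple_col_cons n (x : R) (z : n.-tuple R) :
  tuple_col (tuple_cons (x, z)) = col_mx (x%:M : 'M[R]_1) (tuple_col z) :> 'cV[R]_(1 + n).
Proof.
apply/matrixP => i j; rewrite (ord1 j) [LHS]mxE (tnth_nth 0).
case: (split_ordP i) => k ->; last by rewrite col_mxEd mxE (tnth_nth 0).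
by rewrite col_mxEu (ord1 k) mxE eqxx.
Qed.

Lemma tuple_col_cons2 n (x y : R) (z : n.-tuple R) :
  tuple_col (tuple_cons (x, tuple_cons (y, z))) =
  col_mx (col_mx (x%:M : 'M[R]_1) (y%:M : 'M[R]_1)) (tuple_col z)
    :> 'cV[R]_(1 + 1 + n).
Proof.
apply/matrixP => i j; rewrite (ord1 j) [LHS]mxE (tnth_nth 0).
case: (split_ordP i) => k ->; last by rewrite col_mxEd mxE (tnth_nth 0).
rewrite col_mxEu; case: (split_ordP k) => l ->.
  by rewrite col_mxEu (ord1 l) mxE eqxx.
by rewrite col_mxEd (ord1 l) mxE eqxx.
Qed.

Lemma measurable_tuple_mulmx m n (G : 'M[R]_(m, n)) :
  measurable_fun [set: n.-tuple R] (tuple_mulmx G).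
Proof.
apply/measurable_fun_tnthP => i.
rewrite (_ : _ \o _ = fun x => \sum_j G i j * tnth x j); last first.
  apply/funext => x /=; rewrite tnth_mktuple mxE.
  by apply: eq_bigr => j _; rewrite mxE.
apply: measurable_sum => j; apply: measurable_funM => //.
exact: measurable_tnth.
Qed.

Lemma measurable_sqnorm_tuple_mulmx m n (G : 'M[R]_(m, n)) :
  measurable_fun [set: n.-tuple R] (fun x => sqnorm (G *m tuple_col x)).
Proof.
rewrite (_ : (fun x => _) = @sum_squares R m \o tuple_mulmx G); last first.
  by apply/funext => x /=; apply: eq_bigr => i _; rewrite tnth_mktuple.
apply: measurableT_comp; last exact: measurable_tuple_mulmx.
exact: measurable_sum_squares.
Qed.

Lemma std_normalS n (A : set (n.+1.-tuple R)) : measurable A ->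
  std n.+1 A = (\int[N01]_x std n [set z | A (tuple_cons (x, z))])%E.
Proof.
move=> mA; rewrite /= /distribution /pushforward/=.
rewrite /product_measure1; apply: eq_integral => x _ /=; congr (std n _).
by apply/seteqP; split => z; rewrite /xsection/= inE.
Qed.

Lemma measurable_tuple_cons_section n (A : set (n.+1.-tuple R)) (x : R) : measurable A ->
  measurable [set z : n.-tuple R | A (tuple_cons (x, z))].
Proof.
move=> mA; rewrite -[X in measurable X]setTI.
have mf : measurable_fun [set: n.-tuple R] (fun z => tuple_cons ((x : BR), z)).
  by apply: (measurableT_comp (@measurable_tuple_cons R n)); exact: measurable_fun_pair.
exact: mf.
Qed.

Lemma measurable_std_normal_section2 n (A : set (n.+2.-tuple R)) : measurable A ->
  measurable_fun [set: BR * BR]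
    (fun z => std n [set t | A (tuple_cons (z.1, tuple_cons (z.2, t)))]).
Proof.
move=> mA.
pose f (w : (BR * BR) * n.-tuple R) := tuple_cons (w.1.1, tuple_cons (w.1.2, w.2)).
have mf : measurable_fun setT f.
  have mg : measurable_fun [set: (BR * BR) * n.-tuple R]
      (fun w => tuple_cons (w.1.2, w.2)).
    apply: (measurableT_comp (@measurable_tuple_cons R n)).
    by apply: measurable_fun_pair => //; exact: measurableT_comp.
  apply: (measurableT_comp (@measurable_tuple_cons R n.+1)).
  by apply: measurable_fun_pair => //; exact: measurableT_comp.
have mfA : measurable (f @^-1` A) by rewrite -[X in measurable X]setTI; exact: mf.
have := measurable_fun_xsection (std n) mfA.
congr measurable_fun; apply/funext => z /=; congr (std n _).
by apply/seteqP; split => t; rewrite /xsection/= inE.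
Qed.

(** Invariance under G is stated on sets, so that it can be applied to the
    sections of a set in one more dimension. *)
Definition std_invariant n (G : 'M[R]_n) := forall A, measurable A ->
  std n (tuple_mulmx G @^-1` A) = std n A.

Lemma std_invariant1 n : std_invariant (1%:M : 'M[R]_n).
Proof.
by move=> A _; congr (std n _); apply/seteqP; split => x /=; rewrite tuple_mulmx1.
Qed.

Lemma std_invariantM n (G H : 'M[R]_n) :
  std_invariant G -> std_invariant H -> std_invariant (G *m H).
Proof.
move=> iG iH A mA; rewrite -[RHS]iG// -[RHS]iH//; last first.
  by rewrite -[X in measurable X]setTI; exact: measurable_tuple_mulmx.
by congr (std n _); apply/seteqP; split => x /=; rewrite tuple_mulmxM.
Qed.

Lemma std_invariant_block n (G : 'M[R]_n) : std_invariant G ->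
  std_invariant (block_mx 1%:M 0 0 G : 'M[R]_(1 + n)).
Proof.
move=> iG A mA; have mGA : measurable
    (tuple_mulmx (block_mx 1%:M 0 0 G : 'M[R]_(1 + n)) @^-1` A).
  by rewrite -[X in measurable X]setTI; exact: measurable_tuple_mulmx.
rewrite (std_normalS mGA) (std_normalS mA).
apply: eq_integral => x _; rewrite -[RHS]iG; last exact: measurable_tuple_cons_section.
have E z : tuple_mulmx (block_mx 1%:M 0 0 G : 'M[R]_(1 + n)) (tuple_cons (x, z)) =
    tuple_cons (x, tuple_mulmx G z).
  apply: tuple_col_inj; rewrite tuple_col_mulmx !tuple_col_cons.
  etransitivity; first exact: mul_block_col.
  by rewrite !mul0mx mul1mx addr0 add0r tuple_col_mulmx.
by congr (std n _); apply/seteqP; split => z /=; rewrite E.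
Qed.

(** Integrating out the last n coordinates reduces this to the planar case,
    applied to the measure of the section as a function of the first two
    coordinates. *)
Lemma std_invariant_reflect n (a b : R) : a ^+ 2 + b ^+ 2 = 1 -> b != 0 ->
  std_invariant (block_mx (block_mx a%:M b%:M b%:M (- a)%:M : 'M[R]_(1 + 1))
    0 0 1%:M : 'M[R]_(1 + 1 + n)).
Proof.
move=> ab b0 A mA; set G := block_mx _ _ _ _.
have mGA : measurable (tuple_mulmx G @^-1` A).
  by rewrite -[X in measurable X]setTI; exact: measurable_tuple_mulmx.
have std2 (B : set (n.+2.-tuple R)) : measurable B -> std n.+2 B =
    (\int[N01]_x \int[N01]_y std n [set t | B (tuple_cons (x, tuple_cons (y, t)))])%E.
  move=> mB; rewrite (std_normalS mB); apply: eq_integral => x _.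
  exact: (std_normalS (measurable_tuple_cons_section x mB)).
rewrite (std2 _ mGA) (std2 _ mA).
etransitivity; last first.
  apply: (ge0_integral_normal_reflect ab b0 (measurable_std_normal_section2 mA)) => z.
  exact: measure_ge0.
apply: eq_integral => x _; apply: eq_integral => y _ /=; congr (std n _).
have E z : tuple_mulmx G (tuple_cons (x, tuple_cons (y, z))) =
    tuple_cons (a * x + b * y, tuple_cons (b * x - a * y, z)).
  apply: tuple_col_inj; rewrite tuple_col_mulmx !tuple_col_cons2.
  etransitivity; first exact: mul_block_col.
  rewrite mul_block_col !mul0mx addr0 add0r mul1mx -!scalar_mxM -!raddfD.
  by rewrite mulNr.
by apply/seteqP; split => z /=; rewrite E.
Qed.

End Tuples.

(** * The chi-square law of the squared length of a projection *)

Section Law.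
Context {R : realType}.
Local Notation BR := (measurableTypeR R).
Local Notation N01 := (normal_prob (0 : R) 1).
Local Notation std := (@std_normal_prob R).

(** The tail of q is aligned first, by induction; what remains is a vector
    (s, c, 0, ..., 0), which the reflection with coefficients s / rho and
    c / rho, rho^2 = s^2 + c^2, sends to (rho, 0, ..., 0).  If c = 0, there is
    nothing left to do. *)
Lemma std_invariant_align n (q : 'rV[R]_n.+1) : exists G : 'M[R]_n.+1,
  [/\ std_invariant G, G *m G^T = 1%:M &
      forall j, j != ord0 -> (q *m G) ord0 j = 0].
Proof.
elim: n q => [|n IH] q.
  exists 1%:M; split; [exact: std_invariant1|by rewrite trmx1 mulmx1|].
  by move=> j; rewrite (ord1 j) eqxx.
have [G' [iG' oG' zG']] := IH (rsubmx (q : 'rV[R]_(1 + n.+1))).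
pose s : R := (lsubmx (q : 'rV[R]_(1 + n.+1))) ord0 ord0.
pose c : R := (rsubmx (q : 'rV[R]_(1 + n.+1)) *m G') ord0 ord0.
pose G1 : 'M[R]_(1 + n.+1) := block_mx 1%:M 0 0 G'.
have iG1 : std_invariant (n := n.+2) G1 by exact: std_invariant_block.
have oG1 : G1 *m G1^T = 1%:M.
  rewrite tr_block_mx !trmx0 trmx1 mulmx_block oG' !mul0mx !mulmx0 mul1mx.
  by rewrite !addr0 add0r -scalar_mx_block.
have qG : (q : 'rV[R]_(1 + n.+1)) *m G1 =
    row_mx (lsubmx (q : 'rV[R]_(1 + n.+1)))
      (rsubmx (q : 'rV[R]_(1 + n.+1)) *m G').
  rewrite -[q in LHS](@hsubmxK _ _ 1 n.+1) mul_row_block.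
  by rewrite mulmx1 !mulmx0 addr0 add0r.
have q0 (i : 'I_n.+2) : i = 0 :> nat -> (q *m (G1 : 'M[R]_n.+2)) ord0 i = s.
  move=> i0; rewrite (_ : i = lshift n.+1 (ord0 : 'I_1)); last exact/val_inj.
  rewrite [_ *m _]qG; exact: row_mxEl.
have q1 (i : 'I_n.+2) (k : 'I_n.+1) : i = k.+1 :> nat ->
    (q *m (G1 : 'M[R]_n.+2)) ord0 i =
    (rsubmx (q : 'rV[R]_(1 + n.+1)) *m G') ord0 k.
  move=> ik; rewrite (_ : i = rshift 1 k); last exact/val_inj.
  rewrite [_ *m _ in LHS]qG; exact: row_mxEr.
have qG1 : (q : 'rV[R]_(1 + n.+1)) *m G1 =
    row_mx (row_mx s%:M c%:M : 'rV[R]_(1 + 1)) 0 :> 'rV[R]_(1 + 1 + n).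
  apply/rowP => i; case: (split_ordP (i : 'I_(1 + 1 + n))) => j ->.
    rewrite [RHS]row_mxEl; case: (split_ordP j) => k ->; rewrite (ord1 k).
      by rewrite [RHS]row_mxEl [in RHS]mxE; exact: q0.
    by rewrite [RHS]row_mxEr [in RHS]mxE; exact: q1.
  rewrite [RHS]row_mxEr [RHS]mxE -[RHS](zG' (lift ord0 j))//.
  exact: q1.
have z3 (x : R) (v : 'rV[R]_n.+2) (j : 'I_n.+2) :
    v = row_mx (row_mx x%:M 0 : 'rV[R]_(1 + 1)) 0 :> 'rV[R]_(1 + 1 + n) ->
    j != ord0 -> v ord0 j = 0.
  move=> ->; case: (split_ordP (j : 'I_(1 + 1 + n))) => k ->; last first.
    by move=> _; etransitivity; [exact: row_mxEr|rewrite mxE].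
  case: (split_ordP k) => l -> j0; first by move: j0; rewrite (ord1 l).
  etransitivity; first exact: row_mxEl.
  by rewrite row_mxEr mxE.
have [c0|c0] := eqVneq c 0.
  exists G1; split => // j; apply: (z3 s).
  by rewrite qG1 c0 raddf0.
pose rho := Num.sqrt (s ^+ 2 + c ^+ 2).
have rho0 : 0 < rho.
  by rewrite sqrtr_gt0 ltr_wpDl ?sqr_ge0// exprn_even_gt0.
have rhoE : rho ^+ 2 = s ^+ 2 + c ^+ 2 by rewrite sqr_sqrtr// addr_ge0// sqr_ge0.
have ab : (s / rho) ^+ 2 + (c / rho) ^+ 2 = 1.
  by rewrite !expr_div_n -mulrDl -rhoE divff// expf_neq0// gt_eqF.
have b0 : c / rho != 0 by rewrite mulf_neq0// invr_eq0 gt_eqF.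
have iG2 := std_invariant_reflect (n := n) ab b0.
set S : 'M[R]_(1 + 1) := block_mx _ _ _ _ in iG2.
set G2 : 'M[R]_(1 + 1 + n) := block_mx _ _ _ _ in iG2.
have oS : S *m S^T = 1%:M.
  rewrite tr_block_mx !tr_scalar_mx mulmx_block -!scalar_mxM -!raddfD/=.
  rewrite [RHS](@scalar_mx_block _ 1 1); congr block_mx.
  - by rewrite -ab !expr2.
  - by rewrite mulrN mulrC subrr raddf0.
  - by rewrite mulNr mulrC subrr raddf0.
  - by rewrite mulrNN -ab addrC !expr2.
have oG2 : G2 *m G2^T = 1%:M.
  rewrite tr_block_mx !trmx0 trmx1 mulmx_block oS !mul0mx !mulmx0 mul1mx.
  by rewrite !addr0 add0r -scalar_mx_block.
exists (G1 *m (G2 : 'M[R]_(n.+2))); split.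
- exact: std_invariantM.
- by rewrite trmx_mul -mulmxA (mulmxA G2) oG2 mul1mx.
move=> j; apply: (z3 rho); rewrite mulmxA qG1.
have E : (row_mx (row_mx s%:M c%:M : 'rV[R]_(1 + 1)) 0 : 'rV[R]_(1 + 1 + n)) *m G2 =
    row_mx (row_mx rho%:M 0 : 'rV[R]_(1 + 1)) 0.
  rewrite mul_row_block !mul0mx !mulmx0 !addr0 mul_row_block.
  rewrite -!scalar_mxM -!raddfD/=; congr (row_mx (row_mx _ _) _).
    by congr (_%:M); rewrite mulrA (mulrA c) -mulrDl -!expr2 -rhoE expr2 mulfK// gt_eqF.
  by rewrite mulrN mulrCA subrr raddf0.
exact: E.
Qed.

Lemma sqnorm_scalar (c : R) : sqnorm (c%:M : 'cV[R]_1) = c ^+ 2.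
Proof. by rewrite /sqnorm big_ord1 mxE eqxx. Qed.

Lemma sqnorm_col_mx m n (u : 'cV[R]_m) (v : 'cV[R]_n) :
  sqnorm (col_mx u v) = sqnorm u + sqnorm v.
Proof.
rewrite /sqnorm big_split_ord/=; congr (_ + _); apply: eq_bigr => i _;
  by rewrite ?col_mxEu ?col_mxEd.
Qed.

Lemma sum_squares_cons n (x : R) (z : n.-tuple R) :
  sum_squares (tuple_cons (x, z)) = x ^+ 2 + sum_squares z.
Proof.
rewrite /sum_squares big_ord_recl; congr (_ + _).
by apply: eq_bigr => i _; rewrite tnthS.
Qed.

Lemma chi2_probE d (A : set R) :
  chi2_prob d A = std d [set x | A (sum_squares x)].
Proof. by []. Qed.

Lemma measurable_sum_squares_preimage d (A : set R) : measurable A ->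
  measurable [set x : d.-tuple R | A (sum_squares x)].
Proof. by move=> mA; rewrite -[X in measurable X]setTI; exact: measurable_sum_squares. Qed.

Lemma chi2_probS d (A : set R) : measurable A ->
  chi2_prob d.+1 A = (\int[N01]_x chi2_prob d [set u | A (x ^+ 2 + u)%R])%E.
Proof.
move=> mA; rewrite chi2_probE (std_normalS (measurable_sum_squares_preimage mA)).
apply: eq_integral => x _; rewrite chi2_probE; congr (std d _).
by apply/seteqP; split => z /=; rewrite sum_squares_cons.
Qed.

(** After a change of variables that aligns the first row with the first
    coordinate axis, orthonormality of the rows forces the block form
    diag (c, Q') with c^2 = 1 and Q' again with orthonormal rows; the squared
    length splits accordingly into x^2 + |Q' z|^2, as in [chi2_probS]. *)
Lemma sqnorm_orthonormal_law d n (Q : 'M[R]_(d, n)) (A : set R) :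
  Q *m Q^T = 1%:M -> measurable A ->
  std n [set x | A (sqnorm (Q *m tuple_col x))] = chi2_prob d A.
Proof.
elim: d n Q A => [|d IH] n Q A QQ mA.
  rewrite chi2_probE /=.
  have -> : [set x : n.-tuple R | A (sqnorm (Q *m tuple_col x))] =
      if 0 \in A then setT else set0.
    by apply/seteqP; split => x /=; rewrite /sqnorm big_ord0;
      case: ifPn; rewrite ?inE ?notin_setE.
  rewrite diracE; case: ifPn => A0.
    rewrite probability_setT mem_set//=.
    by move: A0; rewrite inE /sum_squares big_ord0.
  rewrite measure0 memNset//=.
  by move: A0; rewrite notin_setE /sum_squares big_ord0.
case: n Q QQ => [|n] Q QQ.
  move: QQ; rewrite (flatmx0 Q^T) mulmx0 => /matrixP/(_ ord0 ord0)/eqP.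
  by rewrite !mxE eqxx eq_sym oner_eq0.
have [G [iG oG zG]] := std_invariant_align (usubmx (Q : 'M[R]_(1 + d, n.+1))).
pose Q1 : 'M[R]_(1 + d, 1 + n) := Q *m G.
(* the first row of Q1 = Q G is a multiple c of the first basis vector *)
have Q1Q1 : Q1 *m Q1^T = 1%:M.
  by rewrite trmx_mul -mulmxA (mulmxA G) oG mul1mx.
have ur0 : ursubmx Q1 = 0.
  apply/matrixP => i j; rewrite (ord1 i) !mxE -[RHS](zG (rshift 1 j))//.
  by rewrite mxE; apply: eq_bigr => k _; rewrite mxE.
pose c := ulsubmx Q1 ord0 ord0.
have ulE : ulsubmx Q1 = c%:M by rewrite [LHS]mx11_scalar.
have : Q1 *m Q1^T = block_mx 1%:M 0 0 1%:M by rewrite Q1Q1 -scalar_mx_block.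
rewrite -[Q1]submxK ur0 ulE tr_block_mx trmx0 tr_scalar_mx mulmx_block.
rewrite !mul0mx !mulmx0 !addr0 => /eq_block_mx[c1 cv _ QQ'].
have cc : c ^+ 2 = 1.
  by move/matrixP/(_ ord0 ord0): c1; rewrite -scalar_mxM !mxE eqxx.
have c0 : c != 0.
  by apply/eqP => c0; move: cc; rewrite c0 expr0n/= => /esym/eqP; rewrite oner_eq0.
have dl0 : dlsubmx Q1 = 0.
  apply: trmx_inj; rewrite trmx0; apply/eqP.
  by move/eqP: cv; rewrite mul_scalar_mx scaler_eq0 (negbTE c0).
move: QQ'; rewrite dl0 mul0mx add0r => QQ'.
rewrite chi2_probS// -iG; last first.
  by rewrite -[X in measurable X]setTI; exact: measurable_sqnorm_tuple_mulmx.
have mB : measurable (tuple_mulmx G @^-1` [set x | A (sqnorm (Q *m tuple_col x))]).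
  rewrite -[X in measurable X]setTI; apply: measurable_tuple_mulmx => //.
  by rewrite -[X in measurable X]setTI; exact: measurable_sqnorm_tuple_mulmx.
rewrite (std_normalS mB); apply: eq_integral => x _.
rewrite -(IH _ _ _ QQ'); last first.
  rewrite -[X in measurable X]setTI.
  have mf : measurable_fun [set: R] (fun u => x ^+ 2 + u) by exact: measurable_funD.
  exact: mf.
congr (std n _).
have E z : sqnorm (Q *m tuple_col (tuple_mulmx G (tuple_cons (x, z)))) =
    x ^+ 2 + sqnorm (drsubmx Q1 *m tuple_col z).
  have QE : Q1 *m col_mx x%:M (tuple_col z) =
      col_mx (c%:M *m x%:M) (drsubmx Q1 *m tuple_col z).
    by rewrite -[Q1 in LHS]submxK ur0 ulE dl0 mul_block_col !mul0mx addr0 add0r.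
  rewrite tuple_col_mulmx mulmxA -/Q1 tuple_col_cons.
  transitivity (sqnorm (col_mx (c%:M *m x%:M) (drsubmx Q1 *m tuple_col z))).
    by congr sqnorm; exact: QE.
  by rewrite sqnorm_col_mx -scalar_mxM sqnorm_scalar exprMn cc mul1r.
by apply/seteqP; split => z /=; rewrite E.
Qed.

End Law.

(** * Orthonormal bases, projections and least squares *)

Section Orthogonality.
Context {R : realType}.

Definition dot n (u v : 'cV[R]_n) : R := (u^T *m v) ord0 ord0.

Lemma dotE n (u v : 'cV[R]_n) : dot u v = \sum_i u i ord0 * v i ord0.
Proof. by rewrite /dot mxE; apply: eq_bigr => i _; rewrite mxE. Qed.

Lemma dotBr n (u v w : 'cV[R]_n) : dot u (v - w) = dot u v - dot u w.
Proof. by rewrite /dot mulmxBr !mxE. Qed.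

Lemma dotvv n (u : 'cV[R]_n) : dot u u = sqnorm u.
Proof. by rewrite dotE; apply: eq_bigr => i _; rewrite expr2. Qed.

Lemma sqnorm_ge0 n (u : 'cV[R]_n) : 0 <= sqnorm u.
Proof. by apply: sumr_ge0 => i _; exact: sqr_ge0. Qed.

Lemma sqnorm_eq0 n (u : 'cV[R]_n) : sqnorm u = 0 -> u = 0.
Proof.
move=> /eqP; rewrite psumr_eq0; last by move=> i _; exact: sqr_ge0.
move=> /allP u0; apply/matrixP => i j; rewrite (ord1 j) mxE; apply/eqP.
by rewrite -sqrf_eq0; exact: (implyP (u0 i (mem_index_enum i))).
Qed.

Lemma norm2_sqnorm n (u : 'cV[R]_n) : norm2 u ^+ 2 = sqnorm u.
Proof. by rewrite sqr_sqrtr// sqnorm_ge0. Qed.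

Lemma sqnorm_lincomb n (a b : R) (u v : 'cV[R]_n) :
  sqnorm (a *: u - b *: v) =
  a ^+ 2 * sqnorm u - a * b *+ 2 * dot u v + b ^+ 2 * sqnorm v.
Proof.
rewrite dotE /sqnorm !mulr_sumr -sumrB -big_split/=; apply: eq_bigr => i _.
by rewrite !mxE; ring.
Qed.

(** Expansion of the squared norm of |v|^2 u - <u, v> v. *)
Lemma Cauchy_Schwarz n (u v : 'cV[R]_n) : dot u v ^+ 2 <= sqnorm u * sqnorm v.
Proof.
have [/sqnorm_eq0 v0|v0] := eqVneq (sqnorm v) 0.
  by rewrite v0 /dot mulmx0 mxE expr0n/= mulr_ge0// sqnorm_ge0.
have vp : 0 < sqnorm v by rewrite lt_neqAle eq_sym v0 sqnorm_ge0.
rewrite -subr_ge0 -(pmulr_rge0 _ vp).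
suff -> : sqnorm v * (sqnorm u * sqnorm v - dot u v ^+ 2) =
    sqnorm (sqnorm v *: u - dot u v *: v) by exact: sqnorm_ge0.
by rewrite sqnorm_lincomb; ring.
Qed.

Lemma mulmx_tr_eq0 m n (B : 'M[R]_(m, n)) : B *m B^T = 0 -> B = 0.
Proof.
move=> B0; apply/row_matrixP => i; rewrite row0.
apply: trmx_inj; rewrite trmx0; apply: sqnorm_eq0.
rewrite -dotvv /dot trmxK -row_mul.
have := congr1 (fun C : 'M[R]_m => C i i) B0.
by rewrite !mxE => H; rewrite -[RHS]H; apply: eq_bigr => j _; rewrite !mxE.
Qed.

Lemma gram_unit n q (A : 'M[R]_(n, q)) : \rank A = q -> A^T *m A \in unitmx.
Proof.
move=> rA; rewrite -row_free_unit -kermx_eq0; apply/eqP.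
set K := kermx _.
have KA : K *m A^T = 0.
  apply: mulmx_tr_eq0; rewrite trmx_mul trmxK mulmxA -(mulmxA K).
  by rewrite mulmx_ker mul0mx.
have fA : row_free A^T by rewrite /row_free mxrank_tr rA.
by apply: (row_free_inj fA); rewrite KA mul0mx.
Qed.

(** Gram-Schmidt, one vector at a time: normalize a nonzero vector w of the row
    space and continue in the orthogonal complement of w inside that space,
    whose rank is smaller by one. *)
Lemma orthonormal_basis k n (A : 'M[R]_n) : \rank A = k ->
  exists2 Q : 'M[R]_(k, n), Q *m Q^T = 1%:M & (Q <= A)%MS.
Proof.
elim: k A => [|k IH] A rA.
  by exists 0; rewrite ?sub0mx// mul0mx; apply/matrixP => -[].
have A0 : nz_row A != 0 by rewrite nz_row_eq0 -mxrank_eq0 rA.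
pose s := sqnorm (nz_row A)^T.
have s0 : 0 < s.
  rewrite lt_neqAle sqnorm_ge0 andbT eq_sym; apply: contra_neq A0 => /sqnorm_eq0 v0.
  by rewrite -[LHS]trmxK v0 trmx0.
pose w := (Num.sqrt s)^-1 *: nz_row A.
have ww : w *m w^T = 1%:M.
  rewrite /w linearZ/= -scalemxAl -scalemxAr scalerA.
  rewrite [X in _ *: X]mx11_scalar -[X in (X *m _) _ _]trmxK -/(dot _ _) dotvv.
  by rewrite scale_scalar_mx -invfM -expr2 sqr_sqrtr ?(ltW s0)// mulVf// gt_eqF.
have wA : (w <= A)%MS by rewrite scalemx_sub// nz_row_sub.
have rB : \rank (A :&: kermx w^T)%MS = k.
  have := mxrank_mul_ker A w^T; rewrite rA.
  suff -> : \rank (A *m w^T) = 1 by rewrite add1n => -[].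
  apply/eqP; rewrite eqn_leq rank_leq_col lt0n mxrank_eq0.
  apply/eqP => Aw0; move: ww; case/submxP: wA => D {1}->.
  by rewrite -mulmxA Aw0 mulmx0 => /matrixP/(_ ord0 ord0)/eqP;
    rewrite !mxE eqxx eq_sym oner_eq0.
have [Q QQ QB] := IH _ rB.
have /sub_kermxP Qw : (Q <= kermx w^T)%MS by exact: submx_trans QB (capmxSr _ _).
have oC : col_mx w Q *m (col_mx w Q)^T = 1%:M.
  rewrite tr_col_mx mul_col_row ww Qw QQ -[w *m Q^T]trmxK trmx_mul trmxK Qw.
  by rewrite trmx0 -scalar_mx_block.
have CA : (col_mx w Q <= A)%MS.
  by rewrite col_mx_sub wA/=; exact: submx_trans QB (capmxSl _ _).
by exists (col_mx w Q : 'M[R]_(1 + k, n)).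
Qed.

(** The two spaces are orthogonal complements, as no nonzero real vector is
    orthogonal to itself.  This is what makes [orth_proj] the orthogonal
    projection. *)
Lemma row_space_addsmx_ker n q (A : 'M[R]_(n, q)) :
  (1%:M <= <<A^T>> + kermx A)%MS.
Proof.
rewrite sub1mx /row_full.
have := mxrank_sum_cap <<A^T>>%MS (kermx A).
have -> : (<<A^T>> :&: kermx A)%MS = 0.
  set C := (_ :&: _)%MS; apply: mulmx_tr_eq0.
  have /sub_kermxP CA : (C <= kermx A)%MS by exact: capmxSr.
  have : (C <= A^T)%MS by rewrite -(genmxE A^T); exact: capmxSl.
  by case/submxP => D CD; rewrite {2}CD trmx_mul trmxK mulmxA CA mul0mx.
rewrite mxrank0 addn0 genmxE mxrank_tr mxrank_ker => ->.
by rewrite subnKC// rank_leq_row.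
Qed.

Lemma orth_proj_residual n q m (A : 'M[R]_(n, q)) (W : 'M[R]_(m, n)) :
  (W - W *m (orth_proj A)^T <= kermx A)%MS.
Proof.
rewrite /orth_proj trmxK; apply: proj_mx_compl_sub.
by apply: submx_trans (submx1 W) (row_space_addsmx_ker A).
Qed.

Lemma orth_proj_sub n q m (A : 'M[R]_(n, q)) (W : 'M[R]_(m, n)) :
  (W *m (orth_proj A)^T <= A^T)%MS.
Proof. by rewrite /orth_proj trmxK -(genmxE A^T); exact: proj_mx_sub. Qed.

(** Q^T Q is the orthogonal projection onto the column space of X: it fixes this
    space, and Q sees no more of a vector than its projection. *)
Lemma orthonormal_column_basis n p (X : 'M[R]_(n, p)) :
  exists Q : 'M[R]_(\rank X, n),
    [/\ Q *m Q^T = 1%:M, Q *m orth_proj X = Q &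
        forall u : 'cV[R]_n, (u^T <= X^T)%MS -> Q^T *m (Q *m u) = u].
Proof.
have rX : \rank <<X^T>>%MS = \rank X by rewrite genmxE mxrank_tr.
have [Q QQ] := orthonormal_basis rX; rewrite genmxE => QX.
have rQ : \rank Q = \rank X.
  apply/eqP; rewrite eqn_leq rank_leq_row/=.
  by have := mxrankM_maxl Q Q^T; rewrite QQ mxrank1.
have XQ : (X^T <= Q)%MS.
  by have := mxrank_leqif_eq QX => -[_]; rewrite rQ mxrank_tr eqxx => /esym/andP[].
exists Q; split => //.
- have /submxP[D QD] := QX.
  have : (1%:M - (orth_proj X)^T) *m X = 0.
    apply/sub_kermxP; rewrite -[(orth_proj X)^T]mul1mx.
    exact: orth_proj_residual.
  move=> /(congr1 trmx); rewrite trmx_mul trmx0 linearB/= trmx1 trmxK => E.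
  apply/eqP; rewrite -subr_eq0 -[X in _ - X]mulmx1 -mulmxBr -opprB mulmxN oppr_eq0.
  by rewrite QD -mulmxA E mulmx0.
- move=> u uX; have /submxP[D uD] := submx_trans uX XQ.
  rewrite -[u in RHS]trmxK -[u in LHS]trmxK uD trmx_mul.
  by rewrite (mulmxA Q) QQ mul1mx.
Qed.

Section Submodels.
Variables (n p : nat) (X : 'M[R]_(n, p)).

Lemma submodel_col (M : {set 'I_p}) (k : 'I_#|M|) :
  col k (submodel X M) = col (enum_val k) X.
Proof. by apply/matrixP => i j; rewrite !mxE. Qed.

Lemma submodel_sub (M N : {set 'I_p}) : M \subset N ->
  ((submodel X M)^T <= (submodel X N)^T)%MS.
Proof.
move=> /fintype.subsetP MN; apply/row_subP => k.
have jN : enum_val k \in N by apply: MN; exact: enum_valP.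
have -> : row k (submodel X M)^T =
    row (enum_rank_in jN (enum_val k)) (submodel X N)^T.
  by rewrite -!tr_col !submodel_col enum_rankK_in.
exact: row_sub.
Qed.

Lemma submodel_subX (M : {set 'I_p}) : ((submodel X M)^T <= X^T)%MS.
Proof.
by apply/row_subP => k; rewrite -tr_col submodel_col tr_col row_sub.
Qed.

Lemma adj_col_sub (M : {set 'I_p}) (k : 'I_#|M|) :
  ((adj_col X M (enum_val k))^T <= (submodel X M)^T)%MS.
Proof.
rewrite /adj_col linearB/= addmx_sub//.
  by rewrite -submodel_col tr_col row_sub.
rewrite eqmx_opp trmx_mul; apply: submx_trans (orth_proj_sub _ _) _.
by apply: submodel_sub; exact: subD1set.
Qed.

(** The residual X_{j.M} is orthogonal to the columns other than X_j, and its
    product with X_j is its own squared norm. *)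
Lemma adj_col_orth (M : {set 'I_p}) (k : 'I_#|M|) :
  (submodel X M)^T *m adj_col X M (enum_val k) =
  sqnorm (adj_col X M (enum_val k)) *: delta_mx k ord0.
Proof.
set x := adj_col X M (enum_val k).
have xker : (x^T <= kermx (submodel X (M :\ enum_val k)%SET))%MS.
  by rewrite /x /adj_col linearB/= trmx_mul orth_proj_residual.
have xorth j : j \in M -> j != enum_val k -> dot x (col j X) = 0.
  move=> jM jk; have jMk : j \in (M :\ enum_val k)%SET by rewrite !inE jk.
  have -> : col j X = col (enum_rank_in jMk j) (submodel X (M :\ enum_val k)%SET).
    by rewrite submodel_col enum_rankK_in.
  by rewrite /dot colE mulmxA (sub_kermxP xker) mul0mx mxE.
apply/matrixP => l j; rewrite (ord1 j).
have -> : ((submodel X M)^T *m x) l ord0 = dot x (col (enum_val l) X).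
  rewrite dotE mxE; apply: eq_bigr => i _; rewrite !mxE mulrC//.
rewrite [RHS]mxE mxE eqxx andbT.
have [->|lk] := eqVneq l k; last first.
  by rewrite mulr0 xorth ?enum_valP// (inj_eq enum_val_inj).
rewrite mulr1 -dotvv /x {3}/adj_col -/x.
have: dot x (orth_proj (submodel X (M :\ enum_val k)%SET) *m col (enum_val k) X) = 0.
  have := orth_proj_sub (submodel X (M :\ enum_val k)%SET) (col (enum_val k) X)^T.
  move=> /submxP[D /(congr1 trmx)]; rewrite !trmx_mul !trmxK => ->.
  by rewrite /dot mulmxA (sub_kermxP xker) mul0mx mxE.
by rewrite dotBr => ->; rewrite subr0.
Qed.

(** The theorem of Frisch and Waugh: the coefficient of X_j is obtained by
    regression on X_{j.M} alone.  Indeed X_{j.M} = A D for A = X_M and some D,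
    and [adj_col_orth] says that A^T A D is a multiple of the k-th basis
    vector, which determines D. *)
Lemma lse_adj_col (M : {set 'I_p}) (k : 'I_#|M|) (z : 'cV[R]_n) :
  \rank (submodel X M) = #|M| ->
  sqnorm (adj_col X M (enum_val k)) * lse X M z k ord0 =
  dot (adj_col X M (enum_val k)) z.
Proof.
move=> rM; set A := submodel X M; set x := adj_col X M _.
have uA : A^T *m A \in unitmx by exact: gram_unit.
have [D xD] : exists D, x = A *m D.
  case/submxP: (adj_col_sub k) => D xD; exists D^T.
  by apply: trmx_inj; rewrite trmx_mul trmxK.
have DE : D = sqnorm x *: (invmx (A^T *m A) *m delta_mx k ord0).
  rewrite scalemxAr -adj_col_orth -/x -/A xD !mulmxA.
  by rewrite -(mulmxA (invmx _)) mulVmx// mul1mx.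
rewrite /dot [in RHS]xD trmx_mul DE linearZ/= -!scalemxAl [RHS]mxE; congr (_ * _).
rewrite trmx_mul trmx_inv trmx_mul trmxK trmx_delta -/A.
by rewrite -!mulmxA -rowE [RHS]mxE /lse -!mulmxA.
Qed.

(** By [lse_adj_col] the left-hand side is |<x, z>| / |x| for x = X_{j.M}, and
    <x, z> = <Q x, Q z> as x lies in the column space of X. *)
Lemma lse_bound d (Q : 'M[R]_(d, n)) (M : {set 'I_p}) (k : 'I_#|M|) (z : 'cV[R]_n) :
  (forall u : 'cV[R]_n, (u^T <= X^T)%MS -> Q^T *m (Q *m u) = u) ->
  \rank (submodel X M) = #|M| ->
  `|lse X M z k ord0| * norm2 (adj_col X M (enum_val k)) <= norm2 (Q *m z).
Proof.
move=> QX rM; set x := adj_col X M _.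
have xX : (x^T <= X^T)%MS.
  exact: submx_trans (adj_col_sub k) (submodel_subX M).
have xz : dot x z = dot (Q *m x) (Q *m z).
  by rewrite /dot -[x in LHS](QX _ xX) !trmx_mul trmxK -!mulmxA.
have sx : sqnorm (Q *m x) = sqnorm x.
  by rewrite -[LHS]dotvv /dot trmx_mul -mulmxA QX// -/(dot _ _) dotvv.
have [x0|x0] := eqVneq (norm2 x) 0; first by rewrite x0 mulr0 sqrtr_ge0.
have xp : 0 < norm2 x by rewrite lt_neqAle eq_sym x0 sqrtr_ge0.
rewrite -ler_sqr ?nnegrE ?mulr_ge0 ?sqrtr_ge0//.
rewrite exprMn real_normK ?num_real// -(ler_pM2l (exprn_gt0 2 xp)).
have -> : norm2 x ^+ 2 * (lse X M z k ord0 ^+ 2 * norm2 x ^+ 2) =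
    (sqnorm x * lse X M z k ord0) ^+ 2.
  by rewrite norm2_sqnorm; ring.
rewrite lse_adj_col// xz !norm2_sqnorm -[sqnorm x]sx; exact: Cauchy_Schwarz.
Qed.


End Submodels.
End Orthogonality.

(** * Standardization of normal laws, and laws of tuples *)

Section Standardize.
Context {R : realType}.
Local Notation BR := (measurableTypeR R).
Local Notation N01 := (normal_prob (0 : R) 1).
Local Notation leb := (@lebesgue_measure R).
Local Notation std := (@std_normal_prob R).

Lemma measurable_invr : measurable_fun [set: R] (@GRing.inv R).
Proof.
have -> : [set: R] = [set 0] `|` ~` [set 0] by rewrite setUv.
apply/measurable_funU => //; first exact: measurableC.
split; first exact: measurable_fun_set1.
apply: open_continuous_measurable_fun; first exact/closed_openC/closed_eq.
move=> x; rewrite inE/= => /eqP x0; exact: inv_continuous.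
Qed.

Lemma normal_pdf_standardize (m s x : R) : s != 0 ->
  normal_pdf m s (s * x + m) * `|s| = normal_pdf 0 1 x.
Proof.
move=> s0; rewrite !normal_pdfE ?oner_eq0//= mulrAC; congr (_ * _).
  rewrite /normal_peak expr1n -mulrnAr sqrtrM ?sqr_ge0// sqrtr_sqr mul1r.
  by rewrite invfM mulrC mulrA divff ?normr_eq0// mul1r.
rewrite /normal_fun addrK subr0 expr1n; congr expR.
by rewrite exprMn; field.
Qed.

Lemma normal_prob_standardize (m s : R) (A : set BR) : s != 0 -> measurable A ->
  normal_prob m s A = N01 [set x | A (s * x + m)].
Proof.
move=> s0 mA.
have mB : measurable ([set x | A (s * x + m)] : set BR).
  rewrite -[X in measurable X]setTI.
  have mf : measurable_fun [set: BR] (fun x : BR => s * x + m : BR).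
    by apply: measurable_funD => //; exact: measurable_funM.
  exact: mf.
have indE m' s' (B : set BR) : measurable B -> normal_prob m' s' B =
    (\int[leb]_x ((\1_B x)%:E * (normal_pdf m' s' x)%:E))%E.
  move=> mB'; rewrite -[B in LHS]setIT -[LHS]integral_indic//.
  apply: ge0_integral_normal; last by move=> x; rewrite lee_fin.
  by apply/measurable_EFinP; exact: measurable_indic.
rewrite (indE _ _ _ mA) (indE _ _ _ mB).
have mf : measurable_fun [set: BR]
    (fun x => ((\1_A x)%:E * (normal_pdf m s x)%:E)%E).
  apply: emeasurable_funM; apply/measurable_EFinP.
    exact: measurable_indic.
  exact: measurable_normal_pdf.
have f0 (x : BR) : (0 <= (\1_A x)%:E * (normal_pdf m s x)%:E)%E.
  by rewrite mule_ge0// lee_fin// normal_pdf_ge0.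
transitivity (`|s|%:E * \int[leb]_x ((\1_A (s * x + m)%R)%:E *
    (normal_pdf m s (s * x + m)%R)%:E))%E.
  rewrite [X in (_ * X)%E](ge0_integral_affine m s0 mf f0) [RHS]muleA -EFinM.
  by rewrite mulfV ?normr_eq0// mul1e.
rewrite -[LHS]ge0_integralZl//.
- apply: eq_integral => x _.
  rewrite muleCA -EFinM (mulrC `|s|) normal_pdf_standardize//.
- apply: (measurableT_comp mf).
  by apply: measurable_funD => //; exact: measurable_funM.
Qed.

Lemma measurable_rectangle n (A : 'I_n -> set R) :
  (forall i, measurable (A i)) ->
  measurable [set x : n.-tuple R | forall i, A i (tnth x i)].
Proof.
move=> mA; rewrite (_ : [set x | _] =
    \bigcap_(i in [set: 'I_n]) [set x | A i (tnth x i)]).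
  apply: fin_bigcap_measurable; first exact: finite_finset.
  by move=> i _; rewrite -[X in measurable X]setTI; exact: measurable_tnth.
by apply/seteqP; split => x /= h i; [move=> _|]; exact: h.
Qed.

Lemma std_normal_rectangle n (A : 'I_n -> set R) :
  (forall i, measurable (A i)) ->
  std n [set x | forall i, A i (tnth x i)] = (\prod_(i < n) N01 (A i))%E.
Proof.
elim: n A => [|n IH] A mA.
  by rewrite big_ord0 /= diracE mem_set//= => -[].
rewrite big_ord_recl -(IH _ (fun i => mA (lift ord0 i))).
have mR := measurable_rectangle (fun i => mA (lift ord0 i)).
have E : @tuple_cons R n @^-1` [set x | forall i, A i (tnth x i)] =
    A ord0 `*` [set x : n.-tuple R | forall i, A (lift ord0 i) (tnth x i)].
  apply/seteqP; split => -[x z] /=.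
    move=> h; split; first by have := h ord0.
    by move=> i; have := h (lift ord0 i); rewrite tnthS.
  move=> [h0 h] i; case: (unliftP ord0 i) => [j ->|->]; last exact: h0.
  rewrite tnthS; exact: h.
rewrite -[RHS](@product_measure1E _ _ BR (n.-tuple R) _ N01 (std n))//;
  first by rewrite -E.
exact: mA.
Qed.

(** The rectangles are stable under intersection and generate the measurable
    sets of tuples. *)
Lemma tuple_measure_unique n (m1 m2 : probability (n.-tuple R) R) :
  (forall A : 'I_n -> set R, (forall i, measurable (A i)) ->
    m1 [set x | forall i, A i (tnth x i)] =
    m2 [set x | forall i, A i (tnth x i)]) ->
  forall A, measurable A -> m1 A = m2 A.
Proof.
move=> m12 A mA.
pose G : set (set (n.-tuple R)) :=
  [set B | exists2 C : 'I_n -> set R, (forall i, measurable (C i)) &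
    B = [set x | forall i, C i (tnth x i)]].
apply: (@g_sigma_algebra_measure_unique _ _ _ G _ (fun=> setT)) => //.
- by move=> _ [C mC ->]; exact: measurable_rectangle.
- by move=> _; exists (fun=> setT) => //; apply/seteqP; split.
- by apply/seteqP; split => // x _; exists 0.
- move=> _ _ [C mC ->] [D mD ->]; exists (fun i => C i `&` D i).
    by move=> i; exact: measurableI.
  apply/seteqP; split => x /=; first by move=> [hC hD] i; split.
  by move=> h; split => i; have [] := h i.
- by move=> _ [C mC ->]; exact: m12.
- by move=> k; rewrite [X in (X < _)%E](probability_setT m1) ltry.
move: A mA; apply: smallest_sub; first exact: smallest_sigma_algebra.
have sub i : preimage_set_system setT (fun x : n.-tuple R => tnth x i) measurable `<=` G.
  move=> _ [B mB <-]; exists (fun j => if j == i then B else setT).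
    by move=> j; case: ifP.
  apply/seteqP; split => x /=.
    by move=> [_ hB] j; case: eqP => [->|].
  by move=> /(_ i); rewrite eqxx.
move=> B HB; apply: sub_sigma_algebra.
case: n => [|n] in m1 m2 m12 G sub B HB *; first by move: HB; rewrite big_ord0.
move: HB; rewrite -bigcup_mkord_ord => -[i Ii]; exact: sub.
Qed.

End Standardize.

(** * The mean of a normal law *)

Section Mean.
Context {R : realType}.
Local Notation BR := (measurableTypeR R).
Local Notation N01 := (normal_prob (0 : R) 1).
Local Notation leb := (@lebesgue_measure R).

Let idBR : BR -> R := id.

(** From |x| <= 1 + x^2 / 4 <= exp (x^2 / 4), the function |x| exp (- x^2 / 2)
    is at most exp (- x^2 / 4), the density of the normal law of variance 2 up
    to a constant. *)
Lemma integrable_normal_id : N01.-integrable [set: BR] (EFin \o idBR).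
Proof.
have mid : measurable_fun [set: BR] idBR by exact: measurable_id.
apply/integrableP; split; first exact/measurable_EFinP.
have mabs : measurable_fun [set: BR] (fun x : BR => `|idBR x|).
  exact: (measurableT_comp (@normr_measurable R setT) mid).
have s2 : Num.sqrt 2 != 0 :> R by rewrite gt_eqF// sqrtr_gt0.
pose C : R := normal_peak 1 / normal_peak (Num.sqrt 2).
have C0 : 0 <= C by rewrite divr_ge0// normal_peak_ge0.
have bound (x : R) : `|x| * normal_pdf 0 1 x <= C * normal_pdf 0 (Num.sqrt 2) x.
  rewrite !normal_pdfE ?oner_eq0//= /C [leRHS]mulrA divfK; last first.
    by rewrite gt_eqF// normal_peak_gt0.
  rewrite mulrCA ler_wpM2l ?normal_peak_ge0//.
  rewrite /normal_fun subr0 sqr_sqrtr// expr1n.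
  have xe : `|x| <= expR (x ^+ 2 / 4).
    apply: le_trans (expR_ge1Dx _).
    have -> : x ^+ 2 = `|x| ^+ 2 by rewrite real_normK// num_real.
    rewrite -subr_ge0.
    have -> : 1 + `|x| ^+ 2 / 4 - `|x| = (1 - `|x| / 2) ^+ 2 by field.
    exact: sqr_ge0.
  apply: le_trans (ler_wpM2r (expR_ge0 _) xe) _.
  by rewrite -expRD ler_expR le_eqVlt; apply/orP; left; apply/eqP; field.
apply: (@le_lt_trans _ _ (\int[leb]_x (C%:E * (normal_pdf 0 (Num.sqrt 2) x)%:E))%E).
  have -> : (\int[N01]_x `|(EFin \o idBR) x| =
      \int[leb]_x ((`|x|)%:E * (normal_pdf 0 1 x)%:E))%E.
    apply: ge0_integral_normal => //.
    exact/measurable_EFinP.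
  apply: ge0_le_integral => //.
  - by move=> x _; rewrite mule_ge0// lee_fin// normal_pdf_ge0.
  - apply: emeasurable_funM; apply/measurable_EFinP.
      exact: mabs.
    exact: measurable_normal_pdf.
  - apply: emeasurable_funM => //; apply/measurable_EFinP.
    exact: measurable_normal_pdf.
  - by move=> x _; rewrite -!EFinM lee_fin.
rewrite ge0_integralZl//.
- by rewrite integral_normal_pdf mule1 ltry.
- by apply/measurable_EFinP; exact: measurable_normal_pdf.
- by move=> x _; rewrite lee_fin normal_pdf_ge0.
Qed.

Lemma normal_probN (A : set BR) : measurable A ->
  N01 A = N01 [set x | A (- x)].
Proof.
move=> mA; have <- : normal_prob 0 (-1) A = N01 A.
  rewrite /normal_prob; apply: eq_integral => x _; congr _%:E.
  by rewrite !normal_pdfE ?oppr_eq0 ?oner_eq0//= /normal_peak /normal_fun sqrrN.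
rewrite normal_prob_standardize ?oppr_eq0 ?oner_eq0//.
by congr (N01 _); apply/seteqP; split => x /=; rewrite mulN1r addr0.
Qed.

(** By symmetry of the law, the integral is its own opposite; it vanishes as it
    is finite. *)
Lemma integral_normal_id : (\int[N01]_x (idBR x)%:E = 0)%E.
Proof.
have fin : (\int[N01]_x (idBR x)%:E)%E \is a fin_num.
  exact: integrable_fin_num integrable_normal_id.
pose opp : BR -> BR := fun x => - x.
have mopp : measurable_fun [set: BR] opp by exact: measurable_funN.
have : (\int[N01]_x (idBR x)%:E = - \int[N01]_x (idBR x)%:E)%E.
  transitivity (\int[pushforward N01 opp]_x (idBR x)%:E)%E.
    apply: eq_measure_integral => // A mA _; exact: normal_probN.
  have E : (EFin \o idBR) \o opp = (fun x => (-1)%:E * (EFin \o idBR) x)%E.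
    by apply/funext => x /=; rewrite -EFinM mulN1r.
  rewrite integral_pushforward//; last 2 first.
  - exact/measurable_EFinP/measurable_id.
  - by rewrite E; exact: integrableZl integrable_normal_id.
  by rewrite E (integralZl measurableT integrable_normal_id) EFinN mulN1e.
rewrite -(fineK fin) => /eqP; rewrite -EFinN eqe -addr_eq0 -mulr2n mulrn_eq0/=.
by move=> /eqP ->.
Qed.

End Mean.

(** * Normal vectors *)

Section RandomVector.
Context {d0 : measure_display} {T : measurableType d0} {R : realType}.
Variable P : probability T R.
Local Notation BR := (measurableTypeR R).
Local Notation N01 := (normal_prob (0 : R) 1).
Local Notation std := (@std_normal_prob R).
Variables (n : nat) (Y : T -> 'cV[R]_n) (mu : 'cV[R]_n) (sigma : R).
Hypotheses (sigma0 : 0 < sigma) (NY : normal_vector P Y mu sigma).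

Definition standardized (w : T) : n.-tuple R :=
  [tuple (Y w i ord0 - mu i ord0) / sigma | i < n].

Lemma measurable_standardized : measurable_fun [set: T] standardized.
Proof.
apply/measurable_fun_tnthP => i; rewrite (_ : _ \o _ =
  fun w => (Y w i ord0 - mu i ord0) / sigma); last first.
  by apply/funext => w /=; rewrite tnth_mktuple.
by apply: measurable_funM => //; apply: measurable_funB => //; have [+ _] := NY.
Qed.

Lemma standardizedE w i :
  Y w i ord0 = sigma * tnth (standardized w) i + mu i ord0.
Proof. by rewrite tnth_mktuple mulrC divfK ?subrK// gt_eqF. Qed.

Lemma standardized_law (A : set (n.-tuple R)) : measurable A ->
  P (standardized @^-1` A) = std n A.
Proof.
pose W : {mfun T >-> n.-tuple R} := HB.pack standardized
  (isMeasurableFun.Build _ _ _ _ standardized measurable_standardized).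
rewrite -[LHS]/(distribution P W A).
move: A; apply: tuple_measure_unique => A mA.
rewrite (std_normal_rectangle mA) /distribution /pushforward/=.
have mB i : measurable ([set y | A i ((y - mu i ord0) / sigma)] : set BR).
  rewrite -[X in measurable X]setTI.
  have mf : measurable_fun [set: BR] (fun y : BR => (y - mu i ord0) / sigma : BR).
    by apply: measurable_funM => //; exact: measurable_funB.
  by apply: mf => //; exact: mA.
have [_ /(_ (fun i => [set y | A i ((y - mu i ord0) / sigma)]) mB) PE] := NY.
transitivity (\prod_(i < n) normal_prob (mu i ord0) sigma
    [set y | A i ((y - mu i ord0) / sigma)%R])%E.
  rewrite -PE; congr (P _); apply/seteqP; split => w /= h i;
    by have := h i; rewrite /= tnth_mktuple.
apply: eq_bigr => i _; rewrite (normal_prob_standardize _ (lt0r_neq0 sigma0) (mB i)).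
congr (N01 _); apply/seteqP; split => x /=;
  by rewrite addrK mulrC mulKf// gt_eqF.
Qed.

Lemma standardized_coord_law i (B : set BR) : measurable B ->
  P [set w | B (tnth (standardized w) i)] = N01 B.
Proof.
move=> mB.
pose A j := if j == i then B else [set: BR].
have mA j : measurable (A j) by rewrite /A; case: ifP.
transitivity (P (standardized @^-1` [set x | forall j, A j (tnth x j)])).
  congr (P _); apply/seteqP; split => w /=.
    by move=> h j; rewrite /A; case: eqP => [->|].
  by move=> /(_ i); rewrite /A eqxx.
rewrite (standardized_law (measurable_rectangle mA)) (std_normal_rectangle mA).
rewrite (bigD1 i)//= big1 ?mule1; first by rewrite /A eqxx.
by move=> j /negbTE ji; rewrite /A ji probability_setT.
Qed.

Lemma normal_vector_mean i :
  P.-integrable [set: T] (fun w => (Y w i ord0)%:E) /\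
  (\int[P]_w (Y w i ord0)%:E = (mu i ord0)%:E)%E.
Proof.
pose Z w : BR := tnth (standardized w) i.
have mZ : measurable_fun [set: T] Z.
  exact: (measurableT_comp (measurable_tnth i) measurable_standardized).
have YZ w : Y w i ord0 = sigma * Z w + mu i ord0 by exact: standardizedE.
have lawZ (A : set BR) : measurable A -> pushforward P Z A = N01 A.
  exact: standardized_coord_law.
have iZ : P.-integrable [set: T] (fun w => (Z w)%:E).
  apply/integrableP; split; first exact/measurable_EFinP.
  have mabs : measurable_fun [set: BR] (fun x : BR => (`|x|)%:E).
    by apply/measurable_EFinP; exact: normr_measurable.
  have /integrableP[_] := @integrable_normal_id R.
  congr (_ < _)%E; transitivity (\int[pushforward P Z]_x (`|x|)%:E)%E.
    by apply: eq_measure_integral => A mA _; exact: esym (lawZ A mA).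
  by rewrite ge0_integral_pushforward.
have EZ : (\int[P]_w (Z w)%:E = 0)%E.
  rewrite -(@integral_normal_id R).
  transitivity (\int[pushforward P Z]_x x%:E)%E.
    by rewrite integral_pushforward//; exact/measurable_EFinP/measurable_id.
  by apply: eq_measure_integral => A mA _; exact: lawZ.
have YE : (fun w => (Y w i ord0)%:E) =
    (fun w => sigma%:E * (Z w)%:E + (mu i ord0)%:E)%E.
  by apply/funext => w; rewrite YZ.
have iC : P.-integrable [set: T] (fun=> (mu i ord0)%:E).
  exact: finite_measure_integrable_cst.
have isZ : P.-integrable [set: T] (fun w => sigma%:E * (Z w)%:E)%E.
  exact: integrableZl.
split; first by rewrite YE; exact: integrableD.
rewrite YE integralD// integralZl// EZ mule0 add0e.
by rewrite integral_cst//= probability_setT mule1.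
Qed.

End RandomVector.

(** * The bound on the t-statistics *)

Section TStat.
Context {d0 : measure_display} {T : measurableType d0} {R : realType}.
Variable P : probability T R.
Variables (n p : nat) (X : 'M[R]_(n, p)).
Variables (Y : T -> 'cV[R]_n) (mu : 'cV[R]_n) (sigma : R).
Hypotheses (sigma0 : 0 < sigma) (NY : normal_vector P Y mu sigma).

Lemma lse_mean_normal (M : {set 'I_p}) : lse_mean X P Y M = lse X M mu.
Proof.
apply/matrixP => k j; rewrite (ord1 j) [LHS]mxE.
set L := invmx ((submodel X M)^T *m submodel X M) *m (submodel X M)^T.
have lE y : lse X M y k ord0 = \sum_i L k i * y i ord0 by rewrite mxE.
rewrite unlock.
have iY i := (normal_vector_mean sigma0 NY i).1.
rewrite (_ : (fun w => _) =
  (fun w => \sum_(i < n) (L k i)%:E * (Y w i ord0)%:E))%E; last first.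
  by apply/funext => w; rewrite lE -sumEFin.
rewrite integral_sum//; last by move=> i; exact: integrableZl.
rewrite (eq_bigr (fun i => (L k i * mu i ord0)%:E)); last first.
  by move=> i _; rewrite integralZl// (normal_vector_mean sigma0 NY i).2.
by rewrite sumEFin /= lE.
Qed.

(** The right-hand side is the same for all submodels: this is the whole reason
    why Scheffe's constant works for every model universe. *)
Lemma max_abs_t_bound d (Q : 'M[R]_(d, n)) (shat : T -> R)
    (MM : {set {set 'I_p}}) (w : T) :
  (forall u : 'cV[R]_n, (u^T <= X^T)%MS -> Q^T *m (Q *m u) = u) ->
  (0 < shat w) -> model_universe X MM ->
  max_abs_t X P Y shat MM w <= norm2 (Q *m (Y w - mu)) / shat w.
Proof.
move=> QX sw [_ MMsub _].
have B0 : 0 <= norm2 (Q *m (Y w - mu)) / shat w.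
  by rewrite divr_ge0 ?sqrtr_ge0// ltW.
rewrite /max_abs_t; elim/big_ind: _ => // [x y xB yB|M MMM].
  by rewrite ge_max xB.
elim/big_ind: _ => // [x y xB yB|k _]; first by rewrite ge_max xB.
rewrite /t_stat lse_mean_normal.
have /andP[_ /eqP rM] : (M != finset.set0) && (\rank (submodel X M) == #|M|).
  by have := fintype.subsetP MMsub M MMM; rewrite inE.
have -> : lse X M (Y w) k ord0 - lse X M mu k ord0 = lse X M (Y w - mu) k ord0.
  by rewrite /lse mulmxBr !mxE.
have is0 : 0 < (shat w)^-1 by rewrite invr_gt0.
rewrite invfM invrK (mulrC (shat w)^-1) mulrA normrM (gtr0_norm is0) ler_pM2r//.
rewrite normrM (ger0_norm (sqrtr_ge0 _)).
exact: lse_bound.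
Qed.

Lemma max_abs_t_ge0 (shat : T -> R) (MM : {set {set 'I_p}}) (w : T) :
  0 <= max_abs_t X P Y shat MM w.
Proof.
rewrite /max_abs_t; elim/big_ind: _ => // [x y x0 y0|M _].
  by rewrite le_max x0.
by elim/big_ind: _ => // x y x0 y0; rewrite le_max x0.
Qed.

End TStat.

(** * The F law of the pivot, and quantiles *)

Section Joint.
Context {d0 : measure_display} {T : measurableType d0} {R : realType}.
Variable P : probability T R.

(** [F_prob] is defined on the product of the chi-square laws, which is the joint
    law of U and V by independence. *)
Lemma F_prob_ratio_law d r (U V : T -> R) :
  measurable_fun [set: T] U -> measurable_fun [set: T] V ->
  (forall A : set R, measurable A -> P (U @^-1` A) = chi2_prob d A) ->
  (forall A : set R, measurable A -> P (V @^-1` A) = chi2_prob r A) ->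
  independent P U V ->
  forall A : set R, measurable A ->
    F_prob d r A = P [set w | A ((U w / d%:R) / (V w / r%:R))].
Proof.
move=> mU mV lU lV iUV A mA.
have mUV : measurable_fun [set: T] (fun w => (U w, V w)).
  exact: measurable_fun_pair.
have mf : measurable_fun [set: R * R] (fun z : R * R => (z.1 / d%:R) / (z.2 / r%:R)).
  apply: measurable_funM; first exact: measurable_funM.
  by apply: (measurableT_comp (@measurable_invr R)); exact: measurable_funM.
pose m := pushforward P (fun w => (U w, V w)) : {measure set (R * R) -> \bar R}.
rewrite /F_prob {1}/pushforward.
rewrite (@product_measure_unique _ _ _ _ _ (chi2_prob d) (chi2_prob r) (m mUV))//.
  move=> B C mB mC; etransitivity; first exact: (iUV B C mB mC).
  by rewrite (lU _ mB) (lV _ mC).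
by rewrite -[X in measurable X]setTI; exact: mf.
Qed.

End Joint.

Section Pivot.
Context {d0 : measure_display} {T : measurableType d0} {R : realType}.
Variable P : probability T R.

(** In terms of the standardized vector W = (Y - mu) / sigma, the pivot is the
    ratio of U / d and V / r, where U = |Q W|^2 and V = r shat^2 / sigma^2 are
    chi-square variables; they are independent because U only depends on the
    projection H Y. *)
Lemma pivot_F_law (n d r : nat) (Q : 'M[R]_(d, n)) (H : 'M[R]_n)
    (Y : T -> 'cV[R]_n) (mu : 'cV[R]_n) (sigma : R) (shat : T -> R) :
  (0 < d)%N -> (0 < r)%N -> 0 < sigma ->
  Q *m Q^T = 1%:M -> Q *m H = Q ->
  normal_vector P Y mu sigma ->
  measurable_fun [set: T] shat -> (forall w, 0 < shat w) ->
  scaled_chi2 P shat sigma r ->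
  independent P shat (fun w => [tuple (H *m Y w) i ord0 | i < n]) ->
  let Z w := norm2 (Q *m (Y w - mu)) ^+ 2 / (d%:R * shat w ^+ 2) in
  measurable_fun [set: T] Z /\
  forall A : set R, measurable A -> F_prob d r A = P (Z @^-1` A).
Proof.
move=> d_gt0 r_gt0 sigma0 QQ QH NY mshat shat0 chis ind Z.
pose W := standardized Y mu sigma.
have mW : measurable_fun [set: T] W by exact: measurable_standardized NY.
have YW w : Y w - mu = sigma *: tuple_col (W w).
  apply/matrixP => i j; rewrite (ord1 j) !mxE (standardizedE Y mu sigma0 w i).
  by rewrite addrK.
pose U w := sqnorm (Q *m tuple_col (W w)).
pose V w := r%:R * shat w ^+ 2 / sigma ^+ 2.
have d0R : (0 : R) < d%:R by rewrite ltr0n.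
have r0R : (0 : R) < r%:R by rewrite ltr0n.
have mU : measurable_fun [set: T] U.
  exact: (measurableT_comp (measurable_sqnorm_tuple_mulmx Q) mW).
have mV : measurable_fun [set: T] V.
  by apply: measurable_funM => //; apply: measurable_funM => //; exact: measurable_funX.
have lU A : measurable A -> P (U @^-1` A) = chi2_prob d A.
  move=> mA; rewrite -(sqnorm_orthonormal_law QQ mA).
  rewrite -(standardized_law sigma0 NY)//.
  by rewrite -[X in measurable X]setTI; exact: measurable_sqnorm_tuple_mulmx.
have lV A : measurable A -> P (V @^-1` A) = chi2_prob r A.
  move=> mA.
  have mf : measurable_fun [set: R] (fun y => r%:R * y / sigma ^+ 2).
    by apply: measurable_funM => //; exact: measurable_funM.
  have mB : measurable [set y : R | A (r%:R * y / sigma ^+ 2)].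
    by rewrite -[X in measurable X]setTI; exact: mf.
  rewrite -[LHS]/(P [set w | [set y | A (r%:R * y / sigma ^+ 2)] (shat w ^+ 2)]).
  rewrite (chis _ mB) /pushforward; congr (chi2_prob r _).
  have E (x : R) : r%:R * (sigma ^+ 2 * x / r%:R) / sigma ^+ 2 = x.
    by field; rewrite !gt_eqF.
  by apply/seteqP; split => x /=; rewrite E.
have iUV : independent P U V.
  move=> A B mA mB.
  (* Q Y = Q H Y, so U is a function g of the random vector H Y *)
  pose g (t : n.-tuple R) := sqnorm (Q *m tuple_col t - Q *m mu) / sigma ^+ 2.
  have mg : measurable_fun [set: n.-tuple R] g.
    apply: measurable_funM => //; apply: measurable_sum => i.
    apply: measurable_funX.
    under eq_fun do rewrite mxE.
    apply: measurable_funD => //.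
    have := (measurable_fun_tnthP _).1 (measurable_tuple_mulmx Q) i.
    by congr measurable_fun; apply/funext => t /=; rewrite tnth_mktuple.
  have UE w : U w = g [tuple (H *m Y w) i ord0 | i < n].
    rewrite /g (_ : tuple_col _ = H *m Y w); last first.
      by apply/matrixP => i j; rewrite mxE tnth_mktuple (ord1 j).
    rewrite mulmxA QH -mulmxBr YW -scalemxAr /sqnorm mulr_suml.
    by apply: eq_bigr => i _; rewrite [in RHS]mxE exprMn mulrC mulKf// sqrf_eq0 gt_eqF.
  pose h s := r%:R * s ^+ 2 / sigma ^+ 2 : R.
  have mh : measurable_fun [set: R] h.
    by apply: measurable_funM => //; apply: measurable_funM => //; exact: measurable_funX.
  have mgA : measurable (g @^-1` A) by rewrite -[X in measurable X]setTI; exact: mg.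
  have mhB : measurable (h @^-1` B) by rewrite -[X in measurable X]setTI; exact: mh.
  have EA : U @^-1` A =
      (fun w => [tuple (H *m Y w) i ord0 | i < n]) @^-1` (g @^-1` A).
    by apply/seteqP; split => w /=; rewrite UE.
  by have := ind _ _ mhB mgA; rewrite -EA setIC muleC.
have ZE : Z = fun w => (U w / d%:R) / (V w / r%:R).
  apply/funext => w; rewrite /Z /V norm2_sqnorm YW -scalemxAr.
  rewrite (_ : sqnorm (_ *: _) = sigma ^+ 2 * U w); last first.
    by rewrite /U /sqnorm mulr_sumr; apply: eq_bigr => i _; rewrite mxE exprMn.
  by field; rewrite !gt_eqF.
split; last by move=> A mA; rewrite (F_prob_ratio_law mU mV lU lV iUV mA) ZE.
rewrite ZE; apply: measurable_funM; first exact: measurable_funM.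
by apply: (measurableT_comp (@measurable_invr R)); exact: measurable_funM.
Qed.

(** Every x with q <= Q ]-oo, x] makes sqrt (c x) an admissible level for f; the
    inequality passes to the infimum over x, so it is not necessary to know
    that the quantile is attained.  The convergence of the distribution
    function of Z to 1 is used to see that there is such an x, as the infimum
    of the empty set would be 0. *)
Lemma inf_quantile_sqrt_le (Q : set R -> \bar R) (q c : R) (f Z : T -> R) :
  0 < q < 1 -> 0 < c ->
  measurable_fun [set: T] f -> measurable_fun [set: T] Z ->
  (forall A : set R, measurable A -> Q A = P (Z @^-1` A)) ->
  (forall w, 0 <= f w) -> (forall w, 0 <= Z w) ->
  (forall w, f w <= Num.sqrt (c * Z w)) ->
  inf [set K : R | (q%:E <= P [set w | f w <= K]%R)%E] <=
  Num.sqrt (c * quantile Q q).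
Proof.
move=> /andP[q0 q1] c0 mf mZ QE f0 Z0 fZ.
set S := [set K | _].
have QZ x : Q `]-oo, x]%classic = P [set w | Z w <= x].
  by rewrite QE//; congr (P _); apply/seteqP; split => w /=; rewrite in_itv.
have level_ge0 (g : T -> R) (K : R) : (forall w, 0 <= g w) ->
    (q%:E <= P [set w | (g w <= K)%R])%E -> 0 <= K.
  move=> g0 hK; rewrite leNgt; apply/negP => K0.
  move: hK; rewrite (_ : [set w | _] = set0); first by rewrite measure0 lee_fin leNgt q0.
  apply/seteqP; split => // w /= wK.
  by have := g0 w; rewrite leNgt (le_lt_trans wK K0).
have infS_le x : (q%:E <= Q `]-oo, x]%classic)%E -> inf S <= Num.sqrt (c * x).
  move=> Qx; apply: ge_inf; first by exists 0 => K; exact: level_ge0.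
  apply: le_trans Qx _; rewrite QZ; apply: le_measure; rewrite ?inE.
  - rewrite (_ : [set w | _] = setT `&` Z @^-1` `]-oo, x]); first exact: mZ.
    by apply/seteqP; split => w /=; rewrite in_itv/=; [split|case].
  - rewrite (_ : [set w | _] = setT `&` f @^-1` `]-oo, Num.sqrt (c * x)]).
      exact: mf.
    by apply/seteqP; split => w /=; rewrite in_itv/=; [split|case].
  - move=> w /= Zx; apply: le_trans (fZ w) _.
    by rewrite ler_sqrt ?ler_pM2l// mulr_ge0 ?(ltW c0)// (le_trans (Z0 w)).
have infS0 : 0 <= inf S.
  have [->|/set0P Sne] := eqVneq S set0; first by rewrite inf0.
  by apply: lb_le_inf => // K; exact: level_ge0.
have Q0 : [set x | (q%:E <= Q `]-oo, x]%classic)%E] !=set0.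
  pose Zrv : {RV P >-> R} := HB.pack Z (isMeasurableFun.Build _ _ _ _ Z mZ).
  have /(cvg_cdfy1 Zrv) [A [_ h]] : nbhs (1%:E : \bar R) [set y | (q%:E < y)%E].
    apply: open_nbhs_nbhs; split; first exact: open_ereal_gt_ereal.
    by rewrite /= lte_fin.
  exists (A + 1) => /=; rewrite QE//.
  by rewrite -[leRHS]/(cdf Zrv (A + 1)) ltW//; apply: h; rewrite ltrDl.
(* inf S ^ 2 / c is a lower bound of the set whose infimum is the quantile *)
rewrite /quantile -[leLHS]ger0_norm// -sqrtr_sqr; apply: ler_wsqrtr.
rewrite -ler_pdivrMl//; apply: lb_le_inf => // x /= Qx.
have x0 : 0 <= x by apply: (level_ge0 Z) => //; rewrite -QZ.
rewrite ler_pdivrMl// -[leRHS]sqr_sqrtr; last by rewrite mulr_ge0 ?(ltW c0).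
by rewrite ler_sqr ?nnegrE ?sqrtr_ge0//; exact: infS_le.
Qed.

End Pivot.

Theorem proposition4p1 (R : realType) (n p d r : nat) (alpha sigma : R)
  (X : 'M[R]_(n, p)) (mu : 'cV[R]_n)
  (d0 : measure_display) (T : measurableType d0) (P : probability T R)
  (Y : T -> 'cV[R]_n) (shat : {RV P >-> R}) (MM : {set {set 'I_p}}) :
  d = \rank X -> (1 <= d)%N -> (1 <= r)%N ->
  0 < alpha < 1 -> 0 < sigma ->
  normal_vector P Y mu sigma ->
  (forall w, 0 < shat w) ->
  scaled_chi2 P shat sigma r ->
  independent P shat
    (fun w => [tuple (orth_proj X *m Y w) i ord0 | i < n]) ->
  model_universe X MM ->
  PoSI_const X P Y shat MM alpha <= K_Sch alpha d r.
Proof.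
move=> dE d1 r1 /andP[a0 a1] sigma0 NY shat0 chis ind uMM.
have [Q [QQ QH QX]] := orthonormal_column_basis X.
rewrite -dE in Q QQ QH QX.
have mshat : measurable_fun [set: T] shat by [].
have [mZ FZ] := pivot_F_law d1 r1 sigma0 QQ QH NY mshat shat0 chis ind.
have d0R : (0 : R) < d%:R by rewrite ltr0n.
apply: (inf_quantile_sqrt_le _ d0R _ mZ FZ) => [|||w|w].
- by rewrite subr_gt0 a1 gtrBl.
- by apply: measurable_max_abs_t => //; case: NY.
- exact: max_abs_t_ge0.
- by rewrite divr_ge0 ?sqr_ge0// mulr_ge0 ?sqr_ge0.
apply: le_trans (max_abs_t_bound sigma0 NY QX (shat0 w) uMM) _.
suff -> : d%:R * (norm2 (Q *m (Y w - mu)) ^+ 2 / (d%:R * shat w ^+ 2)) =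
    (norm2 (Q *m (Y w - mu)) / shat w) ^+ 2 by rewrite sqrtr_sqr ler_norm.
by field; rewrite !gt_eqF.
Qed.
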